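(* Let $\ell,n,m\in\mathbb{N}^*=\{1,2,\dots\}$. The set $$S=\left\{(E,A,B)\in\Sigma_{\ell,n,m}\;\middle|\;\text{the system } \tfrac{\mathrm{d}}{\mathrm{d}t}(Ex)=Ax+Bu \text{ is controllable in the behavioural sense}\right\}$$ is generic if, and only if, $\ell\neq n+m$.
   Context: $\Sigma_{\ell,n,m}:=\mathbb{R}^{\ell\times n}\times\mathbb{R}^{\ell\times n}\times\mathbb{R}^{\ell\times m}$, identified with $\mathbb{R}^{2\ell n+\ell m}$ by listing matrix entries. A set $\mathbb{V}\subseteq\mathbb{R}^N$ is an algebraic variety if it is the set of common zeros of finitely many polynomials in $\mathbb{R}[x_1,\dots,x_N]$; it is proper if $\mathbb{V}\neq\mathbb{R}^N$. A set $S\subseteq\mathbb{R}^N$ is generic if its complement is contained in some proper algebraic variety. A mapping $(x,u):\mathbb{R}\to\mathbb{R}^n\times\mathbb{R}^m$ is a solution of $\tfrac{\mathrm{d}}{\mathrm{d}t}(Ex)=Ax+Bu$ if $x\in\mathcal{L}^1_{\mathrm{loc}}(\mathbb{R},\mathbb{R}^n)$, $u\in\mathcal{L}^1_{\mathrm{loc}}(\mathbb{R},\mathbb{R}^m)$ (locally integrable functions), $Ex:\mathbb{R}\to\mathbb{R}^\ell$ is (locally) absolutely continuous, and $\tfrac{\mathrm{d}}{\mathrm{d}t}(Ex)(t)=Ax(t)+Bu(t)$ for all $t$ outside a Lebesgue nullset. The set of all solutions is denoted $\mathfrak{B}_{[E,A,B]}$. The system $(E,A,B)$ is controllable in the behavioural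 sense if for all $(x_1,u_1),(x_2,u_2)\in\mathfrak{B}_{[E,A,B]}$ there exist $T>0$ and $(x,u)\in\mathfrak{B}_{[E,A,B]}$ such that $(x,u)(t)=(x_1,u_1)(t)$ for $t<0$ and $(x,u)(t)=(x_2,u_2)(t)$ for $t>T$. *)

(* Defs.v *)
From HB Require Import structures.
From mathcomp Require Import all_boot all_order all_algebra.
From mathcomp Require Import all_classical all_reals all_analysis.
(* The notations of mpoly clash with those of all_analysis. *)
From mathcomp Require Import -(notations) mpoly.

Set Implicit Arguments.
Unset Strict Implicit.
Unset Printing Implicit Defensive.

Import Order.TTheory GRing.Theory Num.Theory.
Import numFieldNormedType.Exports.

Local Open Scope classical_set_scope.
Local Open Scope ring_scope.

Section Generic.
Variables (R : realType) (N : nat).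

Definition algebraic_variety (V : set 'rV[R]_N) : Prop :=
  exists ps : seq (mpoly N R),
    V = [set z | forall p, p \in ps -> meval (fun i => z ord0 i) p = 0].

Definition generic (S : set 'rV[R]_N) : Prop :=
  exists V : set 'rV[R]_N,
    [/\ algebraic_variety V, V <> setT & ~` S `<=` V].

End Generic.

Section Functions.
Variable R : realType.
Implicit Types f : R -> R.

(* The library's [locally_integrable] asks for Borel measurability; integrating
   against the completed measure gives the Lebesgue-measurable functions. *)
Definition L1loc f : Prop :=
  forall K : set R, compact K ->
    (@completed_lebesgue_measure R).-integrable K (EFin \o f).

Definition abs_continuous_on (a b : R) f : Prop :=
  forall e : R, 0 < e -> exists2 d : R, 0 < d &
    forall (k : nat) (s t : 'I_k -> R),
      (forall i, [/\ a <= s i, s i <= t i & t i <= b]) ->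
      trivIset setT (fun i => `]s i, t i[%classic) ->
      \sum_(i < k) (t i - s i) < d ->
      \sum_(i < k) `|f (t i) - f (s i)| < e.

Definition loc_abs_continuous f : Prop :=
  forall a b : R, abs_continuous_on a b f.

End Functions.

Section Systems.
Variables (R : realType) (l n m : nat).

Definition Sigma : Type := ('M[R]_(l, n) * 'M[R]_(l, n) * 'M[R]_(l, m))%type.

Definition Sigma_vec (s : Sigma) : 'rV[R]_(l * n + l * n + l * m) :=
  let: (E, A, B) := s in row_mx (row_mx (mxvec E) (mxvec A)) (mxvec B).

Definition behaviour (s : Sigma) : set (R -> 'cV[R]_n * 'cV[R]_m) :=
  let: (E, A, B) := s in
  [set w | let x (t : R) : 'cV[R]_n := (w t).1 in
           let u (t : R) : 'cV[R]_m := (w t).2 in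
    [/\ forall i, L1loc (fun t => x t i ord0),
        forall j, L1loc (fun t => u t j ord0),
        forall k, loc_abs_continuous (fun t => (E *m x t) k ord0) &
        {ae @lebesgue_measure R, forall t, forall k,
          is_derive (t : R) (1 : R) (fun r : R => (E *m x r) k ord0)
            ((A *m x t + B *m u t) k ord0)}]].

Definition controllable (s : Sigma) : Prop :=
  forall w1 w2, behaviour s w1 -> behaviour s w2 ->
    exists T : R, 0 < T /\ exists w, [/\ behaviour s w,
      forall t, t < 0 -> w t = w1 t & forall t, T < t -> w t = w2 t].

End Systems.

(* Main.v *)
Require Import Defs.
From mathcomp Require Import all_boot all_order all_algebra perm.
From mathcomp Require Import all_classical all_reals all_analysis.
From mathcomp Require Import measurable_realfun spectral.
From mathcomp Require Import -(notations) mpoly complex.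
From mathcomp Require Import ring lra.

(* Everything depends on the pencil [sE - A, -B], of size l x (n + m).

   l < n + m: complete the pencil to n + m - 1 rows by a fixed integrator
   chain. The signed maximal minors c_j form a polynomial kernel vector, so
   x_j = c_j(d/dt) xi (with similar formulas for u) is a solution for every
   polynomial xi. If the n x n matrix of the coefficients of s^0, ..., s^(n-1)
   in c_1, ..., c_n is invertible, Hermite interpolation of xi at 0 and 1 joins
   any two states; this gives controllability. The determinant of that matrix
   is a polynomial in (E, A, B), equal to +1 or -1 at the integrator chain.

   l = n + m: where [E, -B] is invertible, the system reads x' = F x, u = G x.
   A complex eigenvector of F gives a nonzero solution, and a Gronwall argument
   for absolutely continuous functions shows that it cannot be joined to 0. Two
   nonempty Zariski open sets meet, so controllability is not generic.

   l > n + m: the first n + m equations reduce to x' = F x, u = G x, and the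
   next one to c x = 0; differentiating, c F^k x = 0 for all k. Generically the
   observability matrix is invertible, hence x = 0 for every solution. *)

Set Implicit Arguments.
Unset Strict Implicit.
Unset Printing Implicit Defensive.

Import Order.TTheory GRing.Theory Num.Theory.
Import numFieldNormedType.Exports.

Local Open Scope classical_set_scope.
Local Open Scope ring_scope.

(** * Absolutely continuous and locally integrable functions *)

Section AbsolutelyContinuous.
Variable R : realType.
Implicit Types (f g : R -> R) (a b c : R).

Lemma is_derive_increment f (x d e : R) : is_derive x (1 : R) f d -> 0 < e ->
  \forall y \near x, `|f y - f x - d * (y - x)| <= e * `|y - x|.
Proof.
move=> [fx dfx] e0.
have : h^-1 *: ((f \o shift x) (h *: (1 : R)) - f x) @[h --> 0^'] --> d.
  by rewrite -dfx; exact: fx.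
move/cvgrPdist_le => /(_ _ e0).
rewrite near_withinE => /nbhs_ballP[r /= r0 H].
apply/nbhs_ballP; exists r => //= y xy.
have [->|yx] := eqVneq y x; first by rewrite !subrr mulr0 subrr !normr0 mulr0.
have yx0 : y - x != 0 by rewrite subr_eq0.
have := H (y - x); rewrite /ball/= sub0r normrN distrC => /(_ xy yx0).
rewrite [_%:A]mulr1 subrK => le_e.
have -> : f y - f x - d * (y - x) = - ((d - (y - x)^-1 * (f y - f x)) * (y - x)).
  by field.
by rewrite normrN normrM (distrC x) ler_wpM2r.
Qed.

(** A list sorted from left to right, so that the Cousin argument can extend it by appending one
    interval. *)
Let ordered_family (U : set R) (a c : R) (s : seq (R * R)) :=
  [/\ pairwise (fun p q => p.2 <= q.1) s,
      forall p, p \in s -> [/\ a <= p.1, p.1 <= p.2 & p.2 <= c] &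
      forall p, p \in s -> `]p.1, p.2[ `<=` U].

(** The open intervals are disjoint and lie in [U], so their total length is at most the measure of
    [U], and absolute continuity applies. *)
Let ordered_family_variation f a b (e : R) : 0 < e ->
    abs_continuous_on a b f ->
  exists2 d : R, 0 < d & forall U : set R, open U ->
    (lebesgue_measure U < d%:E)%E ->
    forall s, ordered_family U a b s -> \sum_(p <- s) `|f p.2 - f p.1| < e.
Proof.
move=> e0 /(_ _ e0)[d d0 H]; exists d => // U oU mU s [ps abs sU].
pose p (i : 'I_(size s)) := nth (0, 0) s i.
have ps_in i : p i \in s by rewrite mem_nth.
have disj : trivIset setT (fun i => `](p i).1, (p i).2[%classic).
  have lt_disj (i j : 'I_(size s)) : (i < j)%N ->
      `](p i).1, (p i).2[%classic `&` `](p j).1, (p j).2[%classic = set0.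
    move=> ij; rewrite -subset0 => x /=.
    rewrite !in_itv/= => -[/andP[_ x1] /andP[x2 _]].
    have le_ij := pairwiseP (0, 0) ps i j (ltn_ord i) (ltn_ord j) ij.
    by have := lt_trans x1 (le_lt_trans le_ij x2); rewrite ltxx.
  apply/trivIsetP => i j _ _ ij.
  have /orP[?|?] : (i < j)%N || (j < i)%N by rewrite -neq_ltn.
    exact: lt_disj.
  by rewrite setIC; exact: lt_disj.
rewrite (big_nth (0, 0)) big_mkord; apply: (H _ (fst \o p) (snd \o p)) => //.
  by move=> i; exact: abs.
rewrite -lte_fin; apply: le_lt_trans mU.
rewrite -sumEFin.
have -> : (\sum_(i < size s) ((p i).2 - (p i).1)%:E)%E =
    (\sum_(i < size s) lebesgue_measure (`](p i).1, (p i).2[%classic : set R))%E.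
  apply: eq_bigr => i _; rewrite lebesgue_measure_itv/= lte_fin.
  have [_ le12 _] := abs _ (ps_in i).
  by case: ltgtP le12 => // -> _; rewrite subrr.
rewrite -(@measure_bigsetU_ord _ _ _ _ _ xpredT)//.
apply: le_measure; rewrite ?inE.
- by apply: bigsetU_measurable.
- exact: open_measurable.
by elim/big_ind : _ => // [A B AU BU|i _]; [rewrite subUset|exact: sU].
Qed.

(* Cousin's lemma in disguise: an interval [u, v] around a point is short
   enough either for the derivative bound to control f v - f u, or, if the
   point is exceptional, to lie in an open set of small measure, where
   absolute continuity controls the total increment. *)
Lemma abs_continuous_le_increment f a b (C : R) : a <= b -> 0 <= C ->
    abs_continuous_on a b f ->
    {ae @lebesgue_measure R, forall t, a <= t <= b ->
       exists2 d, `|d| <= C & is_derive (t : R) (1 : R) f d} ->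
  `|f b - f a| <= C * (b - a).
Proof.
move=> ab C0 fab [N [mN N0 badN]].
suff key e : 0 < e -> `|f b - f a| <= (C + e) * (b - a) + e.
  apply/ler_addgt0Pr => e e0.
  (* With this value the slope error times [b - a] and the additive error add up to [e]. *)
  have e'0 : 0 < e / (b - a + 1) by rewrite divr_gt0//; lra.
  apply: le_trans (key _ e'0) _.
  rewrite mulrDl -addrA lerD2l.
  have -> : e / (b - a + 1) * (b - a) + e / (b - a + 1) = e; last by [].
  by field; lra.
move=> e0.
have [d d0 small_var] := ordered_family_variation e0 fab.
have [U [oU NU UNd]] : exists U : set R,
    [/\ open U, N `<=` U & (lebesgue_measure U < d%:E)%E].
  have N_fin : (lebesgue_measure N < +oo)%E by rewrite N0.
  have [U [oU NU UNd]] := lebesgue_regularity_outer mN N_fin d0.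
  exists U; split=> //; apply: le_lt_trans UNd.
  have mU : measurable U by exact: open_measurable.
  have mUN : measurable (U `\` N) by exact: measurableD.
  rewrite -{1}(setDKU NU) (le_trans (measureU2 _ _ _))//.
  by rewrite [X in (_ + X <= _)%E]N0 adde0.
(* The bound up to [c], with the increments over intervals inside [U] charged to a separate sum. *)
pose P c := exists2 s, ordered_family U a c s &
  `|f c - f a| <= (C + e) * (c - a) + \sum_(p <- s) `|f p.2 - f p.1|.
suff [s sU le_s] : P b.
  apply: le_trans le_s _; rewrite lerD2l; apply: ltW.
  exact: small_var sU.
have Pa : P a.
  by exists [::]; [split|rewrite big_nil !subrr normr0 mulr0 addr0].
(* Within some radius of [c], [P] passes from the left end to the right end of any interval around
   [c]: by appending the interval to the list if [c] is in [U], by the derivative at [c]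
   otherwise. *)
have gauge c : a <= c <= b -> \forall r \near (0 : R)^'+, forall u v,
    c - r < u -> u <= c -> c <= v -> v < c + r -> a <= u -> v <= b ->
    P u -> P v.
  move=> acb.
  have [Uc|nUc] := pselect (U c).
    have : \forall y \near c, U y by exact: open_nbhs_nbhs.
    move=> /nbhs_ballP[r0 /= r00 HU].
    exists r0 => //= r /=; rewrite sub0r normrN => rr0 r_gt0.
    move=> u v ru uc cv vr au vb [s [ps abs sU] le_s].
    exists (rcons s (u, v)).
      split.
      - rewrite pairwise_rcons ps andbT; apply/allP => p /abs[_ _ /= ?] //.
      - move=> p; rewrite mem_rcons inE => /orP[/eqP->|/abs[? ? ?]] /=.
          by split => //; lra.
        by split => //; lra.
      - move=> p; rewrite mem_rcons inE => /orP[/eqP->|/sU//] /=.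
        move=> y /=; rewrite in_itv/= => /andP[uy yv]; apply: HU.
        rewrite /ball/= ltr_norml; rewrite gtr0_norm// in rr0.
        by apply/andP; split; lra.
    rewrite -cats1 big_cat big_seq1/= addrA.
    have -> : f v - f a = (f u - f a) + (f v - f u) by ring.
    apply: le_trans (ler_normD _ _) _; rewrite lerD2r.
    apply: le_trans le_s _; rewrite lerD2r ler_wpM2l//; lra.
  have [df dfC fdf] : exists2 d, `|d| <= C & is_derive (c : R) (1 : R) f d.
    apply: contrapT => nd; apply/nUc/NU/badN => /(_ acb); exact: nd.
  have /nbhs_ballP[r0 /= r00 Hr] := is_derive_increment fdf e0.
  exists r0 => //= r /=; rewrite sub0r normrN => rr0 r_gt0.
  rewrite gtr0_norm// in rr0.
  move=> u v ru uc cv vr au vb [s [ps abs sU] le_s].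
  have incr y : c - r < y -> y < c + r -> `|f y - f c| <= (C + e) * `|y - c|.
    move=> y1 y2; have /Hr : ball c r0 y.
      by rewrite /ball/= ltr_norml; apply/andP; split; lra.
    move=> /= le_y.
    have -> : f y - f c = (f y - f c - df * (y - c)) + df * (y - c) by ring.
    apply: le_trans (ler_normD _ _) _; rewrite mulrDl addrC lerD//.
    by rewrite normrM ler_wpM2r.
  exists s.
    split => // p /abs[? ? ?]; split => //; lra.
  have -> : f v - f a = (f u - f a) + ((f v - f c) - (f u - f c)) by ring.
  apply: le_trans (ler_normD _ _) _.
  have -> (x : R) : (C + e) * (v - a) + x =
      (C + e) * (u - a) + x + (C + e) * (v - u) by ring.
  rewrite lerD//.
  apply: le_trans (ler_normB _ _) _.
  have Hv : `|f v - f c| <= (C + e) * (v - c).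
    by rewrite -[v - c]ger0_norm ?subr_ge0//; apply: incr; lra.
  have Hu : `|f u - f c| <= (C + e) * (c - u).
    by rewrite -[c - u]ger0_norm ?subr_ge0// (distrC c); apply: incr; lra.
  apply: le_trans (lerD Hv Hu) _; rewrite -mulrDr subrKA//.
(* [P] holds at the supremum of [S] and slightly beyond it as far as [b], so the supremum must be
   [b]. *)
pose S := [set c | a <= c <= b /\ P c].
have Sa : S a by split=> //; rewrite lexx.
have supS : has_sup S.
  by split; [exists a|exists b => c [/andP[]]].
pose c := sup S.
have ac : a <= c by exact: (sup_upper_bound supS).
have cb : c <= b by apply: ge_sup; [exists a|move=> y [/andP[]]].
have [r /= r0 Hr] := gauge c (introT andP (conj ac cb)).
have r20 : 0 < r / 2 by lra.
have rr : `|0 - r / 2| < r by rewrite sub0r normrN gtr0_norm//; lra.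
have {}Hr := Hr (r / 2) rr r20.
have [u [/andP[au ub] Pu] ru] := sup_adherent r20 supS.
have uc : u <= c by apply: sup_upper_bound => //; split => //; apply/andP.
have PP v : c <= v -> v < c + r / 2 -> v <= b -> P v.
  by move=> cv vr vb; apply: (Hr u).
have [cb'|bc] := ltP c b; last by apply: PP => //; lra.
pose v := Num.min b (c + r / 4).
have cv : c < v by rewrite lt_min cb'/=; lra.
have vb : v <= b by rewrite ge_min lexx.
have : v <= c.
  apply: sup_upper_bound => //; split; first by apply/andP; split => //; lra.
  apply: PP => //; [lra|].
  by rewrite /v gt_min; apply/orP; right; lra.
lra.
Qed.

End AbsolutelyContinuous.

(** * Local integrability of continuous and spliced functions *)

Section L1loc.
Variable R : realType.
Implicit Types f g : R -> R.

Let borel_completed (A : set R) : measurable (A : set (measurableTypeR R)) ->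
  measurable (A : set (caratheodory_type (wlength (@idfun R))^*%mu)).
Proof. by move=> mA; exact: sub_caratheodory. Qed.

Lemma continuous_L1loc f : continuous f -> L1loc f.
Proof.
move=> cf K cK; apply: measurable_bounded_integrable.
- by apply: borel_completed; exact: compact_measurable.
- exact: compact_finite_measure.
- move=> _ Y mY; apply: borel_completed; apply: measurableI.
    exact: compact_measurable.
  by rewrite -[X in measurable X]setTI; exact: continuous_measurable_fun.
- have /compact_bounded[M [_ mrt]] := @continuous_compact _ _ f K
    (continuous_subspaceT cf) cK.
  by exists M; split; rewrite ?num_real // => ? ? ? ?; exact: mrt.
Qed.

(** The spliced function is measurable and dominated by [|f| + |g|]. *)
Lemma L1loc_if f g (P : R -> bool) :
    measurable ([set t | P t] : set (measurableTypeR R)) ->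
  L1loc f -> L1loc g -> L1loc (fun t => if P t then f t else g t).
Proof.
move=> mP lf lg K cK.
have mK : measurable (K : set (caratheodory_type (wlength (@idfun R))^*%mu)).
  by apply: borel_completed; exact: compact_measurable.
have {}mP := borel_completed mP.
have fK := lf _ cK; have gK := lg _ cK.
have mf := measurable_int _ fK.
have mg := measurable_int _ gK.
have := integrableD mK (integrable_abse fK) (integrable_abse gK).
apply: le_integrable => //=.
  rewrite (_ : _ \o _ = fun t => if P t then (f t)%:E else (g t)%:E); last first.
    by apply/funext => t /=; case: ifP.
  apply: measurable_fun_if => //.
  + apply: (@measurable_fun_bool _ _ _ _ true).
    rewrite (_ : _ @^-1` _ = [set t | P t]); first exact: measurableI.
    by apply/seteqP; split => t /=; case: (P t).
  + by apply: measurable_funS mf => // x [].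
  + by apply: measurable_funS mg => // x [].
move=> x Kx /=; rewrite lee_fin [leRHS]ger0_norm ?addr_ge0//.
by case: (P x); rewrite ?lerDl ?lerDr.
Qed.

End L1loc.

(** * Closure properties of absolute continuity, and gluing *)

Section AbsolutelyContinuousOperations.
Variable R : realType.
Implicit Types (f g : R -> R) (a b c : R).

Lemma lipschitz_abs_continuous_on f a b (C : R) :
    (forall x y, a <= x -> x <= y -> y <= b -> `|f y - f x| <= C * (y - x)) ->
  abs_continuous_on a b f.
Proof.
move=> lipf e e0; have C1 : 0 < `|C| + 1 by rewrite ltr_wpDl.
exists (e / (`|C| + 1)); first by rewrite divr_gt0.
move=> k s t st _; rewrite ltr_pdivlMr// => lt_e; apply: le_lt_trans lt_e.
rewrite mulr_suml; apply: ler_sum => i _; have [a_s s_t t_b] := st i.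
apply: le_trans (lipf _ _ a_s s_t t_b) _.
rewrite mulrC ler_wpM2l ?subr_ge0//.
by apply: le_trans (ler_norm C) _; rewrite lerDl.
Qed.

Lemma is_derive_continuous f df :
  (forall x, is_derive (x : R) (1 : R) f (df x)) -> continuous f.
Proof.
move=> fdf x; have [fx _] := fdf x.
by apply: differentiable_continuous; exact/derivable1_diffP.
Qed.

(** The extreme value theorem bounds the derivative on a compact interval, and the mean value
    theorem makes [f] Lipschitz there. *)
Lemma derive_abs_continuous f df : (forall x, is_derive (x : R) (1 : R) f (df x)) ->
  continuous df -> loc_abs_continuous f.
Proof.
move=> fdf cdf a b; have [ba|ab] := ltP b a.
  (* For [b < a] the Lipschitz condition is vacuous. *)
  apply: (@lipschitz_abs_continuous_on _ _ _ 0) => x y ax xy yb.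
  by have := le_lt_trans (le_trans ax (le_trans xy yb)) ba; rewrite ltxx.
have cn : {within `[a, b], continuous (fun x => `|df x|)}.
  apply: continuous_subspaceT => x; apply: continuous_comp (cdf x) _.
  exact: norm_continuous.
have [c _ maxc] := EVT_max ab cn.
apply: (@lipschitz_abs_continuous_on _ _ _ `|df c|) => x y ax xy yb.
have cf : {within `[x, y], continuous f}.
  by apply: continuous_subspaceT; exact: is_derive_continuous fdf.
have [z /[!in_itv]/= /andP[xz zy] ->] := MVT_segment xy (fun z _ => fdf z) cf.
rewrite normrM (ger0_norm (_ : 0 <= y - x)) ?subr_ge0//.
rewrite ler_wpM2r ?subr_ge0//; apply: maxc; rewrite in_itv/=.
by rewrite (le_trans ax xz) (le_trans zy yb).
Qed.

Lemma abs_continuous_continuous f : loc_abs_continuous f -> continuous f.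
Proof.
move=> acf x; apply/cvgrPdist_lt => e e0.
have [d d0 H] := acf (x - 1) (x + 1) _ e0.
(* The bound 1 keeps [y] in the interval for which [d] was obtained. *)
have m0 : 0 < Num.min d 1 by rewrite lt_min d0 ltr01.
near=> y.
have : `|x - y| < Num.min d 1.
  by near: y; apply: cvgr_dist_lt.
rewrite lt_min => /andP[xyd]; rewrite ltr_norml => /andP[xy1 xy2].
have key u v : u <= v -> x - 1 <= u -> v <= x + 1 -> v - u < d -> `|f v - f u| < e.
  move=> uv xu vx uvd.
  have := H 1 (fun=> u) (fun=> v); rewrite !big_ord1; apply => //.
  by move=> i j _ _ _; rewrite !ord1.
move: xyd; have [xy|yx] := leP x y.
  rewrite distrC ger0_norm ?subr_ge0// => xyd.
  by rewrite distrC; apply: key => //; lra.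
rewrite gtr0_norm ?subr_gt0// => xyd.
by apply: key => //; lra.
Unshelve. all: by end_near. Qed.

Lemma abs_continuousD f g : loc_abs_continuous f -> loc_abs_continuous g ->
  loc_abs_continuous (f \+ g).
Proof.
move=> acf acg a b e e0; have e2 : 0 < e / 2 by rewrite divr_gt0.
have [d1 d10 H1] := acf a b _ e2; have [d2 d20 H2] := acg a b _ e2.
exists (Num.min d1 d2); first by rewrite lt_min d10.
move=> k s t st disj; rewrite lt_min.
move=> /andP[/(H1 k s t st disj) lt1 /(H2 k s t st disj) lt2].
rewrite [e]splitr; apply: le_lt_trans (ltrD lt1 lt2); rewrite -big_split/=.
apply: ler_sum => i _; apply: le_trans (ler_normD _ _).
by rewrite opprD addrACA.
Qed.

Lemma abs_continuousZ f (c : R) : loc_abs_continuous f ->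
  loc_abs_continuous (fun t => c * f t).
Proof.
move=> acf a b e e0; have C1 : 0 < `|c| + 1 by rewrite ltr_wpDl.
have [d d0 H] := acf a b _ (divr_gt0 e0 C1).
exists d => // k s t st disj /(H k s t st disj); rewrite ltr_pdivlMr//.
apply: le_lt_trans; rewrite mulr_suml; apply: ler_sum => i _.
by rewrite -mulrBr normrM mulrC ler_wpM2l// lerDl.
Qed.

Lemma abs_continuous_cst (c : R) : loc_abs_continuous (fun=> c).
Proof.
move=> a b; apply: (@lipschitz_abs_continuous_on _ _ _ 0) => x y _ _ _.
by rewrite subrr normr0 mul0r.
Qed.

Lemma abs_continuous_sum (I : Type) (r : seq I) (F : I -> R -> R) :
    (forall i, loc_abs_continuous (F i)) ->
  loc_abs_continuous (fun t => \sum_(i <- r) F i t).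
Proof.
move=> acF; elim: r => [|i r IH].
  under eq_fun do rewrite big_nil; exact: abs_continuous_cst.
by under eq_fun do rewrite big_cons; exact: (abs_continuousD (acF i) IH).
Qed.

Lemma abs_continuous_glue f g c : f c = g c ->
    loc_abs_continuous f -> loc_abs_continuous g ->
  loc_abs_continuous (fun t => if t <= c then f t else g t).
Proof.
move=> fgc acf acg a b e e0; have e2 : 0 < e / 2 by rewrite divr_gt0.
have [d1 d10 H1] := acf (Num.min a c) (Num.min b c) _ e2.
have [d2 d20 H2] := acg (Num.max a c) (Num.max b c) _ e2.
exists (Num.min d1 d2); first by rewrite lt_min d10.
move=> k s t st disj; rewrite lt_min => /andP[lt1 lt2].
(* Clamping to either side of [c] is monotone and lengthens no interval, so the clamped families are
   admissible for [f] and [g]. An interval straddling [c] is split there, where [f] and [g]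
   agree. *)
pose lo x := Num.min x c; pose hi x := Num.max x c.
have lo_mono : {homo lo : x y / x <= y}.
  by move=> x y; rewrite /lo; case: (leP x c); case: (leP y c); lra.
have lo_len x y : x <= y -> lo y - lo x <= y - x.
  by rewrite /lo; case: (leP x c); case: (leP y c); lra.
have hi_mono : {homo hi : x y / x <= y}.
  by move=> x y; rewrite /hi; case: (leP x c); case: (leP y c); lra.
have hi_len x y : x <= y -> hi y - hi x <= y - x.
  by rewrite /hi; case: (leP x c); case: (leP y c); lra.
have {}H1 : \sum_(i < k) `|f (lo (t i)) - f (lo (s i))| < e / 2.
  apply: (H1 k (lo \o s) (lo \o t)).
  - by move=> i; have [? ? ?] := st i; split; exact: lo_mono.
  - have sub i x : lo (s i) < x < lo (t i) -> s i < x < t i.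
      by rewrite /lo; case: (leP (s i) c); case: (leP (t i) c); lra.
    move=> i j _ _ [x /= [/[!in_itv]/= /sub xi /sub xj]].
    by apply: disj => //; exists x; rewrite /= !in_itv.
  - apply: le_lt_trans lt1; apply: ler_sum => i _; apply: lo_len.
    by have [] := st i.
have {}H2 : \sum_(i < k) `|g (hi (t i)) - g (hi (s i))| < e / 2.
  apply: (H2 k (hi \o s) (hi \o t)).
  - by move=> i; have [? ? ?] := st i; split; exact: hi_mono.
  - have sub i x : hi (s i) < x < hi (t i) -> s i < x < t i.
      by rewrite /hi; case: (leP (s i) c); case: (leP (t i) c); lra.
    move=> i j _ _ [x /= [/[!in_itv]/= /sub xi /sub xj]].
    by apply: disj => //; exists x; rewrite /= !in_itv.
  - apply: le_lt_trans lt2; apply: ler_sum => i _; apply: hi_len.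
    by have [] := st i.
rewrite [e]splitr; apply: le_lt_trans (ltrD H1 H2); rewrite -big_split/=.
apply: ler_sum => i _; have [_ s_t _] := st i; rewrite /lo /hi.
case: (leP (s i) c) => sc; case: (leP (t i) c) => tc;
  rewrite ?subrr ?normr0 ?addr0 ?add0r//.
  apply: le_trans (ler_normD _ _); rewrite fgc.
  by rewrite (_ : _ - _ + _ = g (t i) - f (s i))//; ring.
by have := lt_le_trans sc (le_trans s_t tc); rewrite ltxx.
Qed.

(** A ball has positive measure, so it cannot lie in the exceptional nullset. *)
Lemma ae_nbhs (P : set R) (x : R) : {ae @lebesgue_measure R, forall t, P t} ->
  forall U : set R, nbhs x U -> exists2 t, U t & P t.
Proof.
move=> [N [mN N0 badN]] U /nbhs_ballP[r /= r0 rU].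
apply: contrapT => nU.
have : (lebesgue_measure (ball x r) <= lebesgue_measure N)%E.
  apply: le_measure; rewrite ?inE//; first exact: measurable_ball.
  by move=> t xt; apply: badN => Pt; apply: nU; exists t => //; exact: rU.
rewrite [X in (_ <= X)%E]N0 [X in (X <= _)%E]lebesgue_measure_ball ?(ltW r0)//.
by rewrite lee_fin leNgt mulrn_wgt0.
Qed.

Lemma ae_eq_continuous f g : continuous f -> continuous g ->
  {ae @lebesgue_measure R, forall t, f t = g t} -> f =1 g.
Proof.
move=> cf cg fg t; apply: contrapT => /eqP; rewrite -subr_eq0 => nfg.
have cfg : f s - g s @[s --> t] --> f t - g t.
  by apply: cvgB; [exact: cf|exact: cg].
have [s] := ae_nbhs fg (cvgr_neq0 _ cfg nfg).
by move=> /= + fgs; rewrite fgs subrr eqxx.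
Qed.

End AbsolutelyContinuousOperations.

(** * Linear differential equations almost everywhere *)

Lemma ae_lebesgue_filter (R : realType) :
  Filter (almost_everywhere (@lebesgue_measure R)).
Proof. exact: (@ae_filter_ringOfSetsType _ _ _ (@lebesgue_measure R)). Qed.
#[local] Hint Extern 0 (Filter (nbhs (almost_everywhere lebesgue_measure))) =>
  exact: ae_lebesgue_filter : typeclass_instances.

Section MatrixDerivative.
Variables (R : realType).

Lemma continuous_sum (I : Type) (F : I -> R -> R) (r : seq I) :
  (forall i, continuous (F i)) -> continuous (fun t => \sum_(i <- r) F i t).
Proof.
move=> cF; elim: r => [|i r IH] t.
  under eq_fun do rewrite big_nil; exact: cvg_cst.
under eq_fun do rewrite big_cons.
by apply: cvgD; [exact: cF|exact: IH].
Qed.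

Lemma is_derive_mulmx (p q : nat) (L : 'M[R]_(p, q)) (y : R -> 'cV[R]_q)
    (d : 'cV[R]_q) (t : R) :
    (forall k, is_derive (t : R) (1 : R) (fun r : R => y r k ord0) (d k ord0)) ->
  forall k, is_derive (t : R) (1 : R) (fun r : R => (L *m y r) k ord0)
    ((L *m d) k ord0).
Proof.
move=> yd k.
under eq_fun do rewrite mxE; rewrite mxE.
rewrite (_ : (fun r => _) =
  \sum_(j < q) (fun r : R => L k j * y r j ord0)); last first.
  by apply/funext => r; rewrite fct_sumE.
exact: is_derive_sum.
Qed.

Lemma abs_continuous_mulmx (p q : nat) (L : 'M[R]_(p, q)) (y : R -> 'cV[R]_q) :
    (forall k, loc_abs_continuous (fun r : R => y r k ord0)) ->
  forall k, loc_abs_continuous (fun r : R => (L *m y r) k ord0).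
Proof.
move=> yd k; under eq_fun do rewrite mxE.
apply: (@abs_continuous_sum _ _ _ (fun j r => L k j * y r j ord0)) => j.
exact: abs_continuousZ.
Qed.

Lemma is_derive_unique (f : R -> R) (t d1 d2 : R) :
  is_derive t (1 : R) f d1 -> is_derive t (1 : R) f d2 -> d1 = d2.
Proof. by move=> [_ <-] [_ <-]. Qed.

End MatrixDerivative.

Section LinearODE.
Variables (R : realType) (n : nat) (F : 'M[R]_n) (x : R -> 'cV[R]_n).
Hypothesis x_ac : forall j, loc_abs_continuous (fun t => x t j ord0).
Hypothesis x_ode : {ae @lebesgue_measure R, forall t, forall j,
  is_derive (t : R) (1 : R) (fun r : R => x r j ord0) ((F *m x t) j ord0)}.

(** Bounds the operator norm of [F] for the l1-norm. *)
Let K := \sum_(j < n) \sum_(k < n) `|F j k|.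

Let K_ge0 : 0 <= K.
Proof. by apply: sumr_ge0 => j _; apply: sumr_ge0. Qed.

(* A Gronwall step: on an interval of length h with K * h < 1, the maximum N of
   the l1-norm of x satisfies N <= K * h * N. *)
Let ode_step (t0 t h : R) : K * h < 1 -> x t0 = 0 -> `|t - t0| <= h -> x t = 0.
Proof.
move=> Kh x0 th; pose N s := \sum_(j < n) `|x s j ord0|.
have N0 s : 0 <= N s by apply: sumr_ge0.
have cN : continuous N.
  apply: (@continuous_sum _ _ (fun j s => `|x s j ord0|)) => j s.
  by apply: cvg_norm; exact: abs_continuous_continuous (x_ac j) _.
have h0 : 0 <= h by apply: le_trans th.
have t0h : t0 - h <= t0 + h by lra.
have [c /[!in_itv]/= /andP[c1 c2] maxc] := EVT_max t0h (continuous_subspaceT cN).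
have ct0 : `|c - t0| <= h by rewrite ler_norml; lra.
(* [N] is at most [N c] on the whole interval, which bounds the derivative of each component between
   [t0] and [c]. *)
have incr j : `|x c j ord0| <= (\sum_(k < n) `|F j k|) * N c * h.
  have C0 : 0 <= (\sum_(k < n) `|F j k|) * N c by rewrite mulr_ge0// sumr_ge0.
  have aeC a b : t0 - h <= a -> b <= t0 + h ->
      {ae @lebesgue_measure R, forall t, a <= t <= b ->
        exists2 d, `|d| <= (\sum_(k < n) `|F j k|) * N c &
          is_derive (t : R) (1 : R) (fun r => x r j ord0) d}.
    move=> ha hb; apply: filterS x_ode => s ds /andP[sa sb].
    exists ((F *m x s) j ord0); last exact: ds.
    rewrite mxE; apply: le_trans (ler_norm_sum _ _ _) _.
    rewrite mulr_suml; apply: ler_sum => k _; rewrite normrM ler_wpM2l//.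
    apply: le_trans (maxc s _); last by rewrite in_itv/=; apply/andP; lra.
    by rewrite /N (bigD1 k)//= lerDl sumr_ge0.
  have xt0 : x t0 j ord0 = 0 by rewrite x0 mxE.
  have [ct|tc] := leP c t0.
    have := abs_continuous_le_increment ct C0 (x_ac j c t0) (aeC _ _ _ _).
    rewrite xt0 sub0r normrN => le_x; apply: le_trans (le_x _ _) _; try lra.
    by rewrite ler_wpM2l//; lra.
  have := abs_continuous_le_increment (ltW tc) C0 (x_ac j t0 c) (aeC _ _ _ _).
  rewrite xt0 subr0 => le_x; apply: le_trans (le_x _ _) _; try lra.
  by rewrite ler_wpM2l//; lra.
have Nc : N c <= K * N c * h.
  by rewrite /K !mulr_suml; apply: ler_sum => j _; exact: incr.
have {}Nc : N c = 0.
  apply/eqP; rewrite eq_le N0 andbT leNgt; apply/negP => Nc0.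
  have : N c * (1 - K * h) <= 0 by lra.
  by rewrite leNgt mulr_gt0//; lra.
have Nt : N t = 0.
  apply/eqP; rewrite eq_le N0 andbT -Nc; apply: maxc.
  by rewrite in_itv/=; move: th; rewrite ler_norml; lra.
apply/matrixP => j k; rewrite ord1 mxE; apply/eqP; rewrite -normr_eq0.
by have /psumr_eq0P := Nt; move=> ->.
Qed.

(** The admissible step length depends only on [F], so finitely many steps lead from [t0] to any
    [t]. *)
Lemma ode_unique (t0 : R) : x t0 = 0 -> forall t, x t = 0.
Proof.
move=> x0 t; pose h := (K + 1)^-1.
have K1 : 0 < K + 1 by have := K_ge0; lra.
have h0 : 0 < h by rewrite invr_gt0.
have Kh : K * h < 1 by rewrite ltr_pdivrMr//; lra.
have steps k : forall t, `|t - t0| <= k%:R * h -> x t = 0.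
  elim: k => [|k IH] {}t.
    by rewrite mul0r normr_le0 subr_eq0 => /eqP ->.
  (* This point lies within [k%:R * h] of [t0] and within [h] of [t]. *)
  move=> tk; pose t' := t0 + k%:R / k.+1%:R * (t - t0).
  have k1 : 0 < k.+1%:R :> R by [].
  apply: (@ode_step t' t h) => //.
    apply: IH; rewrite /t' addrAC subrr add0r normrM ger0_norm ?divr_ge0//.
    by rewrite -mulrA ler_wpM2l// mulrC ler_pdivrMr// mulrC.
  have -> : t - t' = k.+1%:R^-1 * (t - t0).
    by rewrite /t' -natr1; field; rewrite natr1 gt_eqF.
  by rewrite normrM ger0_norm ?invr_ge0// mulrC ler_pdivrMr// mulrC.
apply: (steps (Num.bound (`|t - t0| / h))).
by rewrite -ler_pdivrMr// ltW// archi_boundP// divr_ge0// ltW.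
Qed.

(** Differentiating [d *m x t = 0] gives [d *m F *m x t = 0] almost everywhere, hence everywhere by
    continuity. The iterate is c F^k. *)
Lemma ode_observable (c : 'rV[R]_n) : (forall t, c *m x t = 0) ->
  forall k t, iter k (mulmxr F) c *m x t = 0.
Proof.
move=> cx; elim=> [|k IH] t; first exact: cx.
rewrite iterS/=; set d := iter k _ c in IH *.
have cont (v : 'rV[R]_n) : continuous (fun r => (v *m x r) ord0 ord0).
  apply: abs_continuous_continuous.
  by have := abs_continuous_mulmx v x_ac ord0.
apply/matrixP => i j; rewrite !ord1 [in RHS]mxE.
apply: (@ae_eq_continuous _ (fun r => (d *m F *m x r) ord0 ord0) (fun=> 0)).
- exact: cont.
- exact: cst_continuous.
apply: filterS x_ode => s ds.
have := is_derive_mulmx d ds ord0.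
under eq_fun do rewrite IH mxE.
rewrite mulmxA => dd; exact: (is_derive_unique dd).
Qed.

End LinearODE.

(** * Controllability and its failure *)

Section Gluing.
Variables (R : realType) (l n m : nat).
Variables (E A : 'M[R]_(l, n)) (B : 'M[R]_(l, m)).

(* Only x, not u, has to match at 0 and 1, since u need not be continuous. *)
Lemma interpolation_controllable :
  (forall w1 w2, behaviour (E, A, B) w1 -> behaviour (E, A, B) w2 ->
    exists (p : 'I_n -> {poly R}) (q : 'I_m -> {poly R}),
    [/\ forall k, \sum_j E k j *: (p j)^`() =
          \sum_j A k j *: p j + \sum_j B k j *: q j,
        forall j, (p j).[0] = (w1 0).1 j ord0 &
        forall j, (p j).[1] = (w2 1).1 j ord0]) ->
  controllable (E, A, B).
Proof.
move=> interp w1 w2 Bw1 Bw2; exists 1; split => //.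
have [p [q [pq p0 p1]]] := interp _ _ Bw1 Bw2.
case: Bw1 => x1L u1L x1ac x1d; case: Bw2 => x2L u2L x2ac x2d.
pose w0 (t : R) : 'cV[R]_n * 'cV[R]_m := (\col_j (p j).[t], \col_j (q j).[t]).
pose w t := if t < 0 then w1 t else if t <= 1 then w0 t else w2 t.
exists w; split; last 2 first.
- by move=> t t0; rewrite /w t0.
- by move=> t t1; rewrite /w !leNgt t1 ltNge (ltW (lt_trans ltr01 t1)).
have poly_cont (r : {poly R}) : continuous (fun t => r.[t]).
  exact: is_derive_continuous (is_derive_poly r).
have m0 : measurable ([set t | t < 0] : set (measurableTypeR R)).
  by rewrite -set_itvNyo; exact: measurable_itv.
have m1 : measurable ([set t | t <= 1] : set (measurableTypeR R)).
  by rewrite -set_itvNyc; exact: measurable_itv.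
have Ew0 k t : (E *m (w0 t).1) k ord0 = (\sum_j E k j *: p j).[t].
  rewrite mxE horner_sum; apply: eq_bigr => j _; by rewrite mxE hornerZ.
have w0E : (w0 0).1 = (w1 0).1 by apply/matrixP => j k; rewrite ord1 mxE p0.
have w1E : (w0 1).1 = (w2 1).1 by apply/matrixP => j k; rewrite ord1 mxE p1.
split.
- move=> i; rewrite (_ : (fun t => _) = fun t => if t < 0 then (w1 t).1 i ord0 else
    if t <= 1 then (p i).[t] else (w2 t).1 i ord0); last first.
    apply/funext => t; rewrite /w; case: ifP => // _; case: ifP => // _.
    by rewrite mxE.
  apply: (@L1loc_if _ _ _ (fun t => t < 0)) => //.
  apply: (@L1loc_if _ _ _ (fun t => t <= 1)) => //.
  exact: continuous_L1loc.
- move=> i; rewrite (_ : (fun t => _) = fun t => if t < 0 then (w1 t).2 i ord0 else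
    if t <= 1 then (q i).[t] else (w2 t).2 i ord0); last first.
    apply/funext => t; rewrite /w; case: ifP => // _; case: ifP => // _.
    by rewrite mxE.
  apply: (@L1loc_if _ _ _ (fun t => t < 0)) => //.
  apply: (@L1loc_if _ _ _ (fun t => t <= 1)) => //.
  exact: continuous_L1loc.
- move=> k.
  (* The trajectory is cut at [t < 0], the gluing lemma at [t <= 0]; both agree because the states
     match at 0. *)
  rewrite (_ : (fun t => _) = fun t => if t <= 0 then (E *m (w1 t).1) k ord0 else
    if t <= 1 then (\sum_j E k j *: p j).[t] else (E *m (w2 t).1) k ord0); last first.
    apply/funext => t; rewrite /w [t <= 0]le_eqVlt; have [->|_] := eqVneq t 0.
      by rewrite ltxx ler01 orTb w0E.
    by case: ifP => //= _; case: ifP => // _; rewrite Ew0.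
  apply: abs_continuous_glue => //.
    by rewrite ler01 -w0E Ew0.
  apply: abs_continuous_glue => //.
    by rewrite -w1E Ew0.
  exact: derive_abs_continuous (is_derive_poly _) (poly_cont _).
(* At 0 and 1 the glued function may fail to be differentiable; these points form a nullset. *)
have null2 : {ae @lebesgue_measure R, forall t : R, t != 0 /\ t != 1}.
  exists ([set 0] `|` [set 1]); split; first exact: measurableU.
    exact/countable_lebesgue_measure0/finite_set_countable/finite_set2.
  move=> t /= /not_andP[/negP/negPn/eqP ->|/negP/negPn/eqP ->]; [by left|by right].
have x12 : {ae @lebesgue_measure R, forall t : R, [/\ (t != 0 /\ t != 1),
    forall k, is_derive (t : R) (1 : R) (fun r : R => (E *m (w1 r).1) k ord0)
            ((A *m (w1 t).1 + B *m (w1 t).2) k ord0) &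
    forall k, is_derive (t : R) (1 : R) (fun r : R => (E *m (w2 r).1) k ord0)
            ((A *m (w2 t).1 + B *m (w2 t).2) k ord0)]}.
  by apply: filterS3 null2 x1d x2d => t *; split.
apply: filterS x12 => t [[/negPf t0 /negPf t1] d1 d2] k.
have [t_lt0|t_ge0] := ltP t 0.
  rewrite /= {2 3}/w t_lt0; apply: near_eq_is_derive (d1 k).
  by apply: filterS (lt_nbhsl t_lt0) => r r0; rewrite /w r0.
have {t0}t_gt0 : 0 < t by rewrite lt_neqAle eq_sym t0.
have [t_le1|t_gt1] := leP t 1.
  have {t1 t_le1}t_lt1 : t < 1 by rewrite lt_neqAle t1.
  rewrite /= {2 3}/w ltNge t_ge0/= ltW//.
  have -> : (A *m (w0 t).1 + B *m (w0 t).2) k ord0 =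
      ((\sum_j E k j *: p j)^`()).[t].
    rewrite mxE mxE [X in _ + X]mxE raddf_sum/= !horner_sum.
    under [RHS]eq_bigr do rewrite derivZ.
    rewrite -horner_sum pq hornerD !horner_sum.
    by congr (_ + _); apply: eq_bigr => j _; rewrite mxE hornerZ.
  apply: near_eq_is_derive (is_derive_poly _ _).
  apply: filterS2 (lt_nbhsr t_gt0) (lt_nbhsl t_lt1) => r r0 r1.
  by rewrite /w ltNge (ltW r0) (ltW r1)/= Ew0.
rewrite /= {2 3}/w ltNge t_ge0/= leNgt t_gt1/=; apply: near_eq_is_derive (d2 k).
apply: filterS (lt_nbhsr t_gt1) => r r1.
by rewrite /w ltNge (ltW (lt_trans ltr01 r1)) leNgt r1.
Qed.

End Gluing.

(** * Elimination of x' and u where [leading_mx] is invertible *)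

Section Reduction.
Variables (R : realType) (l n m : nat).
Variables (E A : 'M[R]_(l, n)) (B : 'M[R]_(l, m)) (tau : 'I_(n + m) -> 'I_l).

(** The coefficients of the unknowns x' and u in the rows [tau] of E x' - B u = A x. *)
Definition leading_mx : 'M[R]_(n + m) := row_mx (rowsub tau E) (- rowsub tau B).

(* When leading_mx is invertible, the equations in the rows tau say that
   x' = usubmx G x and u = dsubmx G x for G = reduced_mx. *)
Definition reduced_mx : 'M[R]_(n + m, n) := invmx leading_mx *m rowsub tau A.

Hypothesis leading_unit : leading_mx \in unitmx.
Variable w : R -> 'cV[R]_n * 'cV[R]_m.
Hypothesis Bw : behaviour (E, A, B) w.

Let L := invmx leading_mx.

(** [LE] and [LB] are the two column blocks of [L *m leading_mx = 1]. *)
Let LE : L *m rowsub tau E = col_mx 1%:M 0.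
Proof.
have := mulVmx leading_unit; rewrite -/L /leading_mx mul_mx_row scalar_mx_block.
by rewrite block_mxEh => /eq_row_mx[].
Qed.

Let LB : L *m rowsub tau B = col_mx 0 (- 1%:M).
Proof.
have := mulVmx leading_unit; rewrite -/L /leading_mx mul_mx_row scalar_mx_block.
rewrite block_mxEh => /eq_row_mx[_]; rewrite mulmxN => /(congr1 -%R).
by rewrite opprK opp_col_mx oppr0.
Qed.

Let rowsub_mul p q (M : 'M[R]_(l, p)) (N : 'M[R]_(p, q)) i j :
  (rowsub tau M *m N) i j = (M *m N) (tau i) j.
Proof. by rewrite mul_rowsub_mx mxE. Qed.

Let xE t : (w t).1 = usubmx L *m (rowsub tau E *m (w t).1).
Proof. by rewrite mulmxA mul_usub_mx LE col_mxKu mul1mx. Qed.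

(** By [xE], x is a fixed linear image of E x, whose absolute continuity is part of being a
    solution. *)
Lemma reduced_abs_continuous j : loc_abs_continuous (fun t => (w t).1 j ord0).
Proof.
case: Bw => _ _ xac _; under eq_fun do rewrite xE.
apply: (@abs_continuous_mulmx _ _ _ _ (fun t => rowsub tau E *m (w t).1)) => k.
by under eq_fun do rewrite rowsub_mul; exact: xac.
Qed.

(** The upper half of [L] sends E x to x and kills B u, which gives the differential equation. The
    lower half kills E x, so its derivative 0 leaves an algebraic equation for u. *)
Lemma reduced_ode : {ae @lebesgue_measure R, forall t,
  [/\ forall j, is_derive (t : R) (1 : R) (fun r : R => (w r).1 j ord0)
        ((usubmx reduced_mx *m (w t).1) j ord0),
      (w t).2 = dsubmx reduced_mx *m (w t).1 &
      forall k, is_derive (t : R) (1 : R) (fun r : R => (E *m (w r).1) k ord0)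
        ((A *m (w t).1 + B *m (w t).2) k ord0)]}.
Proof.
case: Bw => _ _ _; apply: filterS => t Ed.
have Td k : is_derive (t : R) (1 : R)
    (fun r : R => (rowsub tau E *m (w r).1) k ord0)
    ((rowsub tau A *m (w t).1 + rowsub tau B *m (w t).2) k ord0).
  under eq_fun do rewrite rowsub_mul.
  by rewrite mxE !rowsub_mul; have := Ed (tau k); rewrite mxE.
split => //.
  move=> j; under eq_fun do rewrite xE.
  suff -> : usubmx reduced_mx *m (w t).1 =
    usubmx L *m (rowsub tau A *m (w t).1 + rowsub tau B *m (w t).2).
    exact: is_derive_mulmx.
  by rewrite mulmxDr !mulmxA !mul_usub_mx LB mul_col_mx col_mxKu mul0mx addr0.
have zero r : dsubmx L *m (rowsub tau E *m (w r).1) = 0.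
  by rewrite mulmxA mul_dsub_mx LE col_mxKd mul0mx.
have := is_derive_mulmx (dsubmx L) Td.
rewrite mulmxDr !mulmxA !mul_dsub_mx LB mul_col_mx col_mxKd mulNmx mul1mx => d0.
apply/matrixP => k j; rewrite ord1; have := d0 k.
under eq_fun do rewrite zero mxE.
move=> /is_derive_unique /(_ (is_derive_cst _ _ _)).
by rewrite mxE [X in _ + X]mxE => /eqP; rewrite subr_eq0 => /eqP <-.
Qed.

(** Substituting the formulas for x' and u into equation [r0] turns it into
    [output_row r0 *m x = 0]. *)
Definition output_row (r0 : 'I_l) : 'rV[R]_n :=
  row r0 E *m usubmx reduced_mx - row r0 A - row r0 B *m dsubmx reduced_mx.

Definition observability_mx (r0 : 'I_l) : 'M[R]_n :=
  \matrix_(k < n) iter k (mulmxr (usubmx reduced_mx)) (output_row r0).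

(** The constraint [output_row r0 *m x = 0] holds almost everywhere, hence everywhere by continuity;
    by [ode_observable] every row of the observability matrix then annihilates x. *)
Lemma observable_eq0 (r0 : 'I_l) : observability_mx r0 \in unitmx ->
  forall t, (w t).1 = 0.
Proof.
move=> obs t.
have ode : {ae @lebesgue_measure R, forall t, forall j,
    is_derive (t : R) (1 : R) (fun r : R => (w r).1 j ord0)
      ((usubmx reduced_mx *m (w t).1) j ord0)}.
  by apply: filterS reduced_ode => s [].
have cx s : output_row r0 *m (w s).1 = 0.
  apply/matrixP => i j; rewrite !ord1 [RHS]mxE.
  apply: (@ae_eq_continuous _ (fun s => (output_row r0 *m (w s).1) ord0 ord0)
    (fun=> 0)).
  - apply: abs_continuous_continuous.
    exact: (abs_continuous_mulmx (output_row r0) reduced_abs_continuous).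
  - exact: cst_continuous.
  apply: filterS reduced_ode => {}s [xd uE Ed].
  have d1 := is_derive_mulmx (row r0 E) xd ord0.
  have := Ed r0.
  have -> : (fun r => (E *m (w r).1) r0 ord0) =
            (fun r => (row r0 E *m (w r).1) ord0 ord0).
    by apply/funext => r; rewrite -row_mul [RHS]mxE.
  move=> /(is_derive_unique d1).
  rewrite /output_row !mulmxBl -!mulmxA -uE => d12.
  rewrite mxE [X in X + _]mxE d12 -!row_mul !mxE.
  by rewrite [X in X + _ + _]addrC addrK subrr.
apply: (can_inj (mulKmx obs)); rewrite mulmx0.
apply/row_matrixP => k; rewrite row_mul rowK row0.
exact: ode_observable reduced_abs_continuous ode _ cx _ _.
Qed.

End Reduction.

Section Overdetermined.
Variables (R : realType) (l n m : nat).

(** Every solution has x = 0, so the zero polynomials interpolate between any two solutions. *)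
Lemma observable_controllable (E A : 'M[R]_(l, n)) (B : 'M[R]_(l, m))
    (tau : 'I_(n + m) -> 'I_l) (r0 : 'I_l) :
  leading_mx E B tau \in unitmx -> observability_mx E A B tau r0 \in unitmx ->
  controllable (E, A, B).
Proof.
move=> lead obs; apply: interpolation_controllable => w1 w2 Bw1 Bw2.
exists (fun=> 0), (fun=> 0); split => [k|j|j].
- by rewrite !big1 ?addr0// => j _; rewrite ?deriv0 scaler0.
- by rewrite horner0 (observable_eq0 lead Bw1 obs) mxE.
- by rewrite horner0 (observable_eq0 lead Bw2 obs) mxE.
Qed.

End Overdetermined.

(** * The square case: an eigenmode that cannot be reached from zero *)

Section Autonomous.
Variable R : realType.

(** These are the real and imaginary parts of a complex eigenvector for the eigenvalue a + ib. *)
Lemma real_imaginary_eigenvector (n : nat) (F : 'M[R]_n) : (0 < n)%N ->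
  exists (a b : R) (vr vi : 'cV[R]_n),
    [/\ F *m vr = a *: vr - b *: vi, F *m vi = b *: vr + a *: vi & vr != 0].
Proof.
move=> n0; pose C := complex R.
(* The matrix is transposed because [eigenvalue] concerns row vectors. *)
pose Fc : 'M[C]_n := \matrix_(i, j) Complex (F j i) 0.
have [[a b] /eigenvalueP[v vF v0]] := eigenvalue_closed Fc n0.
pose vr : 'cV[R]_n := \col_k complex.Re (v ord0 k).
pose vi : 'cV[R]_n := \col_k complex.Im (v ord0 k).
have Re_sum (I : finType) (f : I -> C) :
    complex.Re (\sum_i f i) = \sum_i complex.Re (f i).
  by apply: (big_morph _ (id1 := 0) (op1 := +%R)) => // -[? ?] [].
have Im_sum (I : finType) (f : I -> C) :
    complex.Im (\sum_i f i) = \sum_i complex.Im (f i).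
  by apply: (big_morph _ (id1 := 0) (op1 := +%R)) => // -[? ?] [].
have Fvr : F *m vr = a *: vr - b *: vi.
  apply/matrixP => k j; rewrite !mxE.
  have := congr1 (fun w : 'rV[C]_n => complex.Re (w ord0 k)) vF; rewrite !mxE.
  case: (v ord0 k) => vrk vik /= <-; rewrite Re_sum.
  apply: eq_bigr => i _; rewrite !mxE; case: (v ord0 i) => p q /=; ring.
have Fvi : F *m vi = b *: vr + a *: vi.
  apply/matrixP => k j; rewrite !mxE.
  have := congr1 (fun w : 'rV[C]_n => complex.Im (w ord0 k)) vF; rewrite !mxE.
  rewrite [b * _ + _]addrC.
  case: (v ord0 k) => vrk vik /= <-; rewrite Im_sum.
  apply: eq_bigr => i _; rewrite !mxE; case: (v ord0 i) => p q /=; ring.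
exists a, b; have [vr0|vr0] := eqVneq vr 0; last by exists vr, vi; split.
(* Multiply the eigenvector by the imaginary unit. *)
exists (- vi), vr; split.
- by rewrite mulmxN Fvi opprD scalerN addrC.
- by rewrite Fvr scalerN addrC.
rewrite oppr_eq0; apply: contraNneq v0 => vi0; apply/eqP/matrixP => i k.
rewrite ord1 mxE.
have /(congr1 (fun w : 'cV[R]_n => w k ord0)) := vr0.
have /(congr1 (fun w : 'cV[R]_n => w k ord0)) := vi0.
by rewrite !mxE; case: (v ord0 k) => p q /= -> ->.
Qed.

(** The function is the real part of exp((a + ib)t)(p + iq). *)
Lemma is_derive_eigenmode (a b p q t : R) :
  is_derive (t : R) (1 : R)
    (fun t => expR (a * t) * (cos (b * t) * p - sin (b * t) * q))
    (expR (a * t) *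
     (cos (b * t) * (a * p - b * q) - sin (b * t) * (b * p + a * q))).
Proof.
have lin (c : R) : is_derive (t : R) (1 : R) (fun t => c * t) c.
  by apply: is_derive_eq; rewrite [_%:A]mulr1.
have dexp := is_derive1_comp (is_derive_expR (a * t)) (lin a).
have dcos := is_derive1_comp (is_derive_cos (b * t)) (lin b).
have dsin := is_derive1_comp (is_derive_sin (b * t)) (lin b).
apply: is_derive_eq.
rewrite !scaler0 /GRing.scale/=; ring.
Qed.

Lemma continuous_mulmx (p q : nat) (M : 'M[R]_(p, q)) (x : R -> 'cV[R]_q) :
    (forall j, continuous (fun t => x t j ord0)) ->
  forall j, continuous (fun t => (M *m x t) j ord0).
Proof.
move=> xc j; under eq_fun do rewrite mxE.
apply: (@continuous_sum _ _ (fun k t => M j k * x t k ord0)) => k t.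
by apply: cvgM; [exact: cvg_cst|exact: xc].
Qed.

Lemma ode_abs_continuous (n : nat) (F : 'M[R]_n) (x : R -> 'cV[R]_n) :
    (forall t j, is_derive (t : R) (1 : R) (fun r : R => x r j ord0)
      ((F *m x t) j ord0)) ->
  forall j, loc_abs_continuous (fun t => x t j ord0).
Proof.
move=> xd j; apply: derive_abs_continuous (fun t => xd t j) _.
apply: continuous_mulmx => k.
exact: is_derive_continuous (fun t => xd t k).
Qed.

Variables (n m : nat) (E A : 'M[R]_(n + m, n)) (B : 'M[R]_(n + m, m)).
Hypothesis lead : leading_mx E B id \in unitmx.

Let G := reduced_mx E A B id.

(** Converse of the reduction: [G] solves [E, -B] G = A, so the reduced equations imply the original
    ones. *)
Lemma reduced_ode_behaviour (x : R -> 'cV[R]_n) :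
  (forall t j, is_derive (t : R) (1 : R) (fun r : R => x r j ord0)
     ((usubmx G *m x t) j ord0)) ->
  behaviour (E, A, B) (fun t => (x t, dsubmx G *m x t)).
Proof.
move=> xd.
have xac := ode_abs_continuous xd.
have xc j : continuous (fun t => x t j ord0) by exact: abs_continuous_continuous.
split => /=.
- by move=> j; exact: continuous_L1loc.
- by move=> j; apply: continuous_L1loc; exact: continuous_mulmx.
- exact: abs_continuous_mulmx.
apply: aeW => t.
suff -> : A *m x t + B *m (dsubmx G *m x t) = E *m (usubmx G *m x t).
  exact: is_derive_mulmx.
have : row_mx E (- B) *m col_mx (usubmx G) (dsubmx G) = A.
  have := lead; rewrite vsubmxK /G /reduced_mx /leading_mx !mxsub_id.
  by move=> leadE; rewrite mulmxA mulmxV ?mul1mx.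
rewrite mul_row_col mulNmx => /(canRL (subrK _)) EG.
by rewrite !mulmxA EG mulmxDl.
Qed.

(** A solution joining zero to the eigenmode vanishes for t < 0, hence always. The eigenmode would
    then vanish after [T], hence also at 0, where it equals [vr]. *)
Lemma autonomous_uncontrollable : (0 < n)%N -> ~ controllable (E, A, B).
Proof.
move=> n0 ctr.
have [a [b [vr [vi [Fr Fi vr0]]]]] := real_imaginary_eigenvector (usubmx G) n0.
pose x (t : R) := expR (a * t) *: (cos (b * t) *: vr - sin (b * t) *: vi).
have xd t j : is_derive (t : R) (1 : R) (fun r : R => x r j ord0)
     ((usubmx G *m x t) j ord0).
  rewrite /x -scalemxAr mulmxBr -!scalemxAr Fr Fi !mxE.
  under eq_fun do rewrite !mxE.
  exact: is_derive_eigenmode.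
have zd (t : R) (j : 'I_n) :
    is_derive (t : R) (1 : R) (fun r : R => (0 : 'cV[R]_n) j ord0)
     ((usubmx G *m (0 : 'cV[R]_n)) j ord0).
  by rewrite mulmx0 !mxE; exact: is_derive_cst.
have [T [T0 [w [Bw w_lt w_gt]]]] :=
  ctr _ _ (reduced_ode_behaviour (x := fun=> 0) zd) (reduced_ode_behaviour xd).
have w0 : forall t, (w t).1 = 0.
  apply: (ode_unique (reduced_abs_continuous lead Bw) _ (t0 := -1)).
    by apply: filterS (reduced_ode lead Bw) => t [].
  by rewrite w_lt//= ltrN10.
have xT : x (T + 1) = 0 by rewrite -(w0 (T + 1)) w_gt//= ltrDl.
have x0 : x 0 = 0.
  by apply: (ode_unique (ode_abs_continuous xd) _ xT); exact: aeW.
move/eqP: vr0; apply.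
by move: x0; rewrite /x !mulr0 expR0 cos0 sin0 !scale1r scale0r subr0.
Qed.

End Autonomous.

(** * Polynomial trajectories *)

Section DifferentialOperator.
Variable R : realType.
Implicit Types (c d p xi : {poly R}) (a : R).

(* c(d/dt) xi *)
Definition diff_op c xi : {poly R} := \sum_(i < size c) c`_i *: xi^`(i).

Lemma diff_opE N c xi : (size c <= N)%N ->
  diff_op c xi = \sum_(i < N) c`_i *: xi^`(i).
Proof.
move=> cN; rewrite /diff_op (big_ord_widen N (fun i => c`_i *: xi^`(i)) cN).
rewrite big_mkcond; apply: eq_bigr => i _.
by case: ltnP => // ci; rewrite nth_default ?scale0r.
Qed.

Lemma diff_opD c d xi : diff_op (c + d) xi = diff_op c xi + diff_op d xi.
Proof.
pose N := maxn (size c) (size d).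
rewrite !(@diff_opE N) ?leq_maxl ?leq_maxr ?size_polyD// -big_split.
by apply: eq_bigr => i _; rewrite coefD scalerDl.
Qed.

Lemma diff_opZ a c xi : diff_op (a *: c) xi = a *: diff_op c xi.
Proof.
rewrite (@diff_opE (size c)) ?size_scale_leq// /diff_op scaler_sumr.
by apply: eq_bigr => i _; rewrite coefZ scalerA.
Qed.

Lemma diff_op0 xi : diff_op 0 xi = 0.
Proof. by rewrite /diff_op size_poly0 big_ord0. Qed.

Lemma diff_op_sum (I : Type) (r : seq I) (c : I -> {poly R}) xi :
  diff_op (\sum_(i <- r) c i) xi = \sum_(i <- r) diff_op (c i) xi.
Proof.
by apply: (big_morph (diff_op^~ xi) _ (diff_op0 xi)) => c1 c2; exact: diff_opD.
Qed.

Lemma diff_opMX c xi : diff_op ('X * c) xi = (diff_op c xi)^`().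
Proof.
rewrite (@diff_opE (size c).+1); last first.
  rewrite mulrC; have [->|c0] := eqVneq c 0; first by rewrite mul0r size_poly0.
  by rewrite size_mulX.
rewrite big_ord_recl coefXM scale0r add0r /diff_op raddf_sum.
by apply: eq_bigr => i _; rewrite coefXM/= derivZ -derivnS.
Qed.

Lemma diff_opDr c p xi : diff_op c (p + xi) = diff_op c p + diff_op c xi.
Proof.
by rewrite /diff_op -big_split; apply: eq_bigr => i _; rewrite derivnD scalerDr.
Qed.

Lemma derivn_XsubC_exp a k i :
  (('X - a%:P) ^+ k)^`(i) = ('X - a%:P) ^+ (k - i) *+ (k ^_ i).
Proof.
elim: i => [|i IH]; first by rewrite subn0 ffactn0.
rewrite derivnS IH derivMn deriv_exp derivXsubC mul1r -mulrnA.
by rewrite subnS ffactnSr mulnC.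
Qed.

(** Each derivation lowers the multiplicity of the root [a] by at most one. *)
Lemma horner_derivn_dvd a K p i : ('X - a%:P) ^+ K %| p -> (i < K)%N ->
  p^`(i).[a] = 0.
Proof.
move=> /dvdpP[r ->]; elim: i K r => [|i IH] [|K] r // iK.
  by rewrite derivn0 hornerM horner_exp hornerXsubC subrr expr0n mulr0.
rewrite derivSn derivM deriv_exp derivXsubC mul1r/=.
have -> : r^`() * ('X - a%:P) ^+ K.+1 + r * (('X - a%:P) ^+ K *+ K.+1) =
    (r^`() * ('X - a%:P) + r *+ K.+1) * ('X - a%:P) ^+ K.
  by rewrite mulrDl -mulrA -exprS mulrnAr mulrnAl.
exact: IH.
Qed.

Lemma diff_op_dvd a c p : ('X - a%:P) ^+ size c %| p -> (diff_op c p).[a] = 0.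
Proof.
move=> dvd; rewrite horner_sum big1// => i _.
by rewrite hornerZ (horner_derivn_dvd dvd)// mulr0.
Qed.

(** Chinese remaindering: the two powers [P] and [Q] are coprime, and in [u * P + v * Q = 1] the
    term [v * Q] is 1 modulo [P] and 0 modulo [Q]. *)
Lemma hermite_interpolation (a b : R) K p0 p1 : a != b ->
  exists2 xi, ('X - a%:P) ^+ K %| xi - p0 & ('X - b%:P) ^+ K %| xi - p1.
Proof.
move=> ab.
have /Bezout_eq1_coprimepP[[u v] /= uv] :
    coprimep (('X - a%:P) ^+ K) (('X - b%:P) ^+ K).
  by rewrite coprimep_expl// coprimep_expr// coprimep_XsubC root_XsubC eq_sym.
set P := _ ^+ K in uv *; set Q := _ ^+ K in uv *.
exists (p0 * (v * Q) + p1 * (u * P)).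
  have -> : p0 * (v * Q) + p1 * (u * P) - p0 =
      (p1 - p0) * (u * P) + p0 * (u * P + v * Q - 1) by ring.
  by rewrite uv subrr mulr0 addr0 mulrA dvdp_mull.
have -> : p0 * (v * Q) + p1 * (u * P) - p1 =
    (p0 - p1) * (v * Q) + p1 * (u * P + v * Q - 1) by ring.
by rewrite uv subrr mulr0 addr0 mulrA dvdp_mull.
Qed.

(* xi has derivatives V^-1 x of order < n at a, where V is the matrix below, and
   vanishing higher derivatives. *)
Lemma diff_op_surjective (n : nat) (c : 'I_n -> {poly R}) a (x : 'cV[R]_n) :
    \matrix_(j < n, k < n) (c j)`_k \in unitmx ->
  exists xi, forall j, (diff_op (c j) xi).[a] = x j ord0.
Proof.
set V := \matrix_(j, k) _ => Vu.
pose y := invmx V *m x.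
(* [c j] may have more or fewer than [n] coefficients; padding [y] with zeros covers both cases. *)
pose yy i := if insub i is Some k then y k ord0 else 0.
exists (\sum_(k < n) (y k ord0 / k`!%:R) *: ('X - a%:P) ^+ k) => j.
have jet i : ((\sum_(k < n) (y k ord0 / k`!%:R) *: ('X - a%:P) ^+ k)^`(i)).[a] =
    yy i.
  rewrite /yy raddf_sum horner_sum.
  have term (k : 'I_n) : (((y k ord0 / k`!%:R) *: ('X - a%:P) ^+ k)^`(i)).[a] =
     if k == i :> nat then y k ord0 else 0.
    rewrite derivnZ derivn_XsubC_exp hornerZ hornerMn horner_exp hornerXsubC subrr.
    have [<-|ki] := eqVneq.
      by rewrite subnn expr0 ffactnn divfK// pnatr_eq0 -lt0n fact_gt0.
    have [ik|ik|/eqP] := ltngtP i k; last by rewrite eq_sym (negPf ki).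
      by rewrite expr0n subn_eq0 leqNgt ik mul0rn mulr0.
    by rewrite ffact_small// mulr0n mulr0.
  under eq_bigr do rewrite term.
  case: insubP => [k _ <-|/= ni].
    rewrite (bigD1 k)//= eqxx big1 ?addr0// => h.
    by rewrite -val_eqE => /negPf ->.
  by rewrite big1// => k _; case: eqP => // ki; rewrite -ki ltn_ord in ni.
rewrite (@diff_opE (maxn (size (c j)) n)) ?leq_maxl// horner_sum.
under eq_bigr do rewrite hornerZ jet.
transitivity ((V *m y) j ord0); last by rewrite mulKVmx.
rewrite mxE (eq_bigr (fun i : 'I_n => (c j)`_i * yy i)); last first.
  by move=> i _; rewrite mxE /yy valK.
rewrite (big_ord_widen _ (fun i => (c j)`_i * yy i) (leq_maxr (size (c j)) n)).
rewrite [RHS]big_mkcond.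
apply: eq_bigr => i _; case: ltnP => // ni; rewrite /yy insubF ?mulr0//.
by rewrite ltnNge ni.
Qed.

End DifferentialOperator.

(** * The underdetermined case: a polynomial kernel vector of the pencil *)

Section Underdetermined.
Variables (R : realType) (l n m : nat).
Hypothesis n_gt0 : (0 < n)%N.
Variables (E A : 'M[R]_(l, n)) (B : 'M[R]_(l, m)).

Definition pencil_entry (r : 'I_l) (j : 'I_(n + m)) : {poly R} :=
  match fintype.split j with
  | inl k => (E r k)%:P * 'X - (A r k)%:P
  | inr k => - (B r k)%:P
  end.

(* The integrator chain x_k' = x_(k+1), x_n' = u_1, u_2 = ... = u_m = 0. *)
Definition chain_entry (r j : nat) : {poly R} :=
  (((r == j) && (r < n)%N)%:R)%:P * 'X - ((j == r.+1)%:R)%:P.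

(* Row 0 is a dummy; the others are the rows of [sE - A, -B], completed by
   rows of the integrator chain to n + m - 1 rows. *)
Definition square_pencil : 'M[{poly R}]_(n + m) :=
  \matrix_(i, j) if i == 0 :> nat then 0
    else if insub i.-1 is Some r then pencil_entry r j else chain_entry i.-1 j.

Definition first_row : 'I_(n + m) := Ordinal (ltn_addr m n_gt0).

(** Cofactors along the dummy row: the signed maximal minors of the remaining rows. *)
Definition pencil_kernel (j : 'I_(n + m)) : {poly R} :=
  cofactor square_pencil first_row j.

(** Sends the derivatives of xi of order below [n] at a point to the state x there, if the higher
    derivatives vanish. *)
Definition jet_mx : 'M[R]_n :=
  \matrix_(j, k) (pencil_kernel (lshift m j))`_k.

(** This is an off-diagonal entry of the product of the matrix with its adjugate. *)
Lemma square_pencil_kernel (i : 'I_(n + m)) : i != 0 :> nat ->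
  \sum_j square_pencil i j * pencil_kernel j = 0.
Proof.
move=> i0; have := congr1 (fun M : 'M[{poly R}]_(n + m) => M i first_row)
  (mul_mx_adj square_pencil).
rewrite !mxE -val_eqE/= (negPf i0) mulr0n => eq0; rewrite -[RHS]eq0.
by apply: eq_bigr => j _; congr (_ * _); rewrite mxE.
Qed.

Hypothesis l_lt : (l < n + m)%N.

Lemma pencil_kernelE (r : 'I_l) :
  \sum_j (E r j *: ('X * pencil_kernel (lshift m j))) =
  \sum_j (A r j *: pencil_kernel (lshift m j)) +
  \sum_j (B r j *: pencil_kernel (rshift n j)).
Proof.
(* The dummy row shifts row [r] of the pencil to row [r.+1]. *)
pose i := Ordinal (leq_ltn_trans (ltn_ord r) l_lt).
have := square_pencil_kernel (i := i) isT.
under eq_bigr do rewrite mxE /= valK.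
rewrite big_split_ord/= => /eqP.
under eq_bigr do rewrite /pencil_entry (unsplitK (inl _)) mulrBl -mulrA !mul_polyC.
rewrite sumrB addrAC subr_eq0 => /eqP.
under [X in _ + X]eq_bigr do rewrite /pencil_entry (unsplitK (inr _)) mulNr mul_polyC.
by rewrite sumrN => /eqP; rewrite subr_eq => /eqP.
Qed.

(** [xi0] and [xi1] realise the two prescribed states, and one [xi] agrees with both to high order.
    Read as differential operators, [pencil_kernelE] gives the system equations. *)
Lemma jet_controllable : jet_mx \in unitmx -> controllable (E, A, B).
Proof.
move=> Vu; apply: interpolation_controllable => w1 w2 _ _.
pose c j := pencil_kernel (lshift m j).
have [xi0 H0] := @diff_op_surjective R n c 0 (w1 0).1 Vu.
have [xi1 H1] := @diff_op_surjective R n c 1 (w2 1).1 Vu.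
have ne01 : (0 : R) != 1 by rewrite eq_sym oner_eq0.
(* Every [c j] differentiates fewer than [K] times, so polynomials congruent modulo this power give
   the same state. *)
pose K := \max_j size (c j).
have [xi d0 d1] := hermite_interpolation K xi0 xi1 ne01.
exists (fun j => diff_op (c j) xi).
exists (fun j => diff_op (pencil_kernel (rshift n j)) xi).
have agree a p j : ('X - a%:P) ^+ K %| xi - p ->
    (diff_op (c j) xi).[a] = (diff_op (c j) p).[a].
  move=> dvd; rewrite -{1}(subrK p xi) diff_opDr hornerD diff_op_dvd ?add0r//.
  by apply: dvdp_trans dvd; apply: dvdp_exp2l; exact: leq_bigmax.
split => [r|j|j]; last 2 first.
- by rewrite (agree _ xi0).
- by rewrite (agree _ xi1).
have := congr1 (fun p => @diff_op R p xi) (pencil_kernelE r).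
rewrite diff_opD !diff_op_sum.
under eq_bigr do rewrite diff_opZ diff_opMX.
under [X in _ = X + _]eq_bigr do rewrite diff_opZ.
by under [X in _ = _ + X]eq_bigr do rewrite diff_opZ.
Qed.

End Underdetermined.

(** * The integrator chain, where the jet matrix is invertible *)

Section Chain.
Variables (R : realType) (l n m : nat).
Hypothesis n_gt0 : (0 < n)%N.

Definition chain_E : 'M[R]_(l, n) := \matrix_(r, j) (r == j :> nat)%:R.
Definition chain_A : 'M[R]_(l, n) := \matrix_(r, j) (j == r.+1 :> nat)%:R.
Definition chain_B : 'M[R]_(l, m) := \matrix_(r, j) (n + j == r.+1)%:R.

Let Q := square_pencil chain_E chain_A chain_B.

(** The completing rows continue the same chain, so one formula covers all rows below the dummy one,
    whatever [l] is. *)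
Let chain_pencilE (i j : 'I_(n + m)) : i != 0 :> nat -> Q i j = chain_entry R n i.-1 j.
Proof.
move=> i0; rewrite mxE (negPf i0); case: insubP => //= r _ ri.
rewrite /pencil_entry /chain_entry -ri.
case: (splitP j) => k jk; rewrite !mxE jk.
  suff -> : (r == k :> nat) && (r < n)%N = (r == k :> nat) by [].
  by case: eqP => //= ->; rewrite ltn_ord.
suff -> : (r == n + k :> nat) && (r < n)%N = false by rewrite mul0r sub0r.
by case: eqP => //= ->; rewrite ltnNge leq_addr.
Qed.

Let c j := pencil_kernel n_gt0 chain_E chain_A chain_B j.

(** Deleting row 0 and column 0 leaves a lower triangular matrix with -1 on the diagonal. *)
Let c0 : c (first_row m n_gt0) = (-1) ^+ (n + m).-1.
Proof.
rewrite /c /pencil_kernel /cofactor addnn -signr_odd odd_double expr0 mul1r.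
rewrite det_trig.
  rewrite (eq_bigr (fun=> -1)); first by rewrite prodr_const card_ord.
  move=> i _; rewrite mxE mxE chain_pencilE//= /chain_entry /bump/=.
  by rewrite ltn_eqF//= mul0r sub0r eqxx.
apply/is_trig_mxP => i j ij; rewrite mxE mxE chain_pencilE//= /chain_entry /bump/=.
rewrite !add1n eqSS (gtn_eqF ij) ltn_eqF; last exact: ltnW.
by rewrite mul0r subrr.
Qed.

(** For j < n, the chain row for x_j' states that X c_j = c_(j+1), with indices from 0; the
    recursion starts at [c0]. *)
Let cX (j : 'I_(n + m)) : (j <= n)%N -> c j = 'X^j * (-1) ^+ (n + m).-1.
Proof.
case: j => j; elim: j => [|j IH] jnm jn.
  by rewrite expr0 mul1r -c0; congr c; exact: val_inj.
have := @square_pencil_kernel R l n m n_gt0 chain_E chain_A chain_B (Ordinal jnm) isT.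
have jnm' : (j < n + m)%N by apply: ltnW.
rewrite (bigD1 (Ordinal jnm))//= (bigD1 (Ordinal jnm'))/=; last first.
  by rewrite -val_eqE/= ltn_eqF.
rewrite big1 ?addr0; last first.
  move=> k /andP[]; rewrite -!val_eqE/= => kj1 kj.
  rewrite -/Q chain_pencilE//= /chain_entry eq_sym (negPf kj) (negPf kj1).
  by rewrite mul0r subrr mul0r.
rewrite -/Q !chain_pencilE//= /chain_entry/= !eqxx jn (ltn_eqF (ltnSn j)) /=.
rewrite mul0r sub0r mulN1r subr0 mul1r => /eqP; rewrite addrC subr_eq0 => /eqP eq_c.
transitivity ('X * c (Ordinal jnm')); first by rewrite /c eq_c.
by rewrite IH ?exprS ?mulrA// ltnW.
Qed.

Lemma chain_jet_unit : jet_mx n_gt0 chain_E chain_A chain_B \in unitmx.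
Proof.
suff -> : jet_mx n_gt0 chain_E chain_A chain_B = ((-1) ^+ (n + m).-1)%:M.
  by rewrite unitmxE det_scalar unitfE !expf_neq0 ?oppr_eq0 ?oner_eq0.
apply/matrixP => j k; rewrite !mxE -/(c _) cX; last exact: ltnW (ltn_ord j).
have -> : (-1) ^+ (n + m).-1 = ((-1) ^+ (n + m).-1)%:P :> {poly R}.
  by rewrite rmorphXn rmorphN1.
by rewrite mulrC coefCM coefXn/= mulr_natr eq_sym.
Qed.

End Chain.

(** * Polynomial functions of the system matrices *)

Section ClosedFamily.
Variables (S : comNzRingType) (Z : Type) (P : (Z -> S) -> Prop).

(** Shared by three families: polynomial functions, polynomial-valued functions whose coefficients
    are such, and fractions. Each is thus closed under determinants. *)
Definition subring_family :=
  [/\ forall c, P (fun=> c), forall f g, P f -> P g -> P (fun z => f z + g z) &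
      forall f g, P f -> P g -> P (fun z => f z * g z)].

Hypothesis subP : subring_family.

Lemma family_cst c : P (fun=> c). Proof. by case: subP => + _ _; exact. Qed.

Lemma familyD f g : P f -> P g -> P (fun z => f z + g z).
Proof. by case: subP => _ + _; exact. Qed.

Lemma familyM f g : P f -> P g -> P (fun z => f z * g z).
Proof. by case: subP => _ _; exact. Qed.

Lemma familyN f : P f -> P (fun z => - f z).
Proof.
move=> Pf; under eq_fun do rewrite -mulN1r.
exact: familyM (family_cst _) Pf.
Qed.

Lemma family_sum (I : Type) (r : seq I) (F : I -> Z -> S) :
  (forall i, P (F i)) -> P (fun z => \sum_(i <- r) F i z).
Proof.
move=> PF; elim: r => [|i r IH].
  by under eq_fun do rewrite big_nil; exact: family_cst.
by under eq_fun do rewrite big_cons; exact: familyD.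
Qed.

Lemma family_prod (I : Type) (r : seq I) (F : I -> Z -> S) :
  (forall i, P (F i)) -> P (fun z => \prod_(i <- r) F i z).
Proof.
move=> PF; elim: r => [|i r IH].
  by under eq_fun do rewrite big_nil; exact: family_cst.
by under eq_fun do rewrite big_cons; exact: familyM.
Qed.

Lemma family_det (n : nat) (M : Z -> 'M[S]_n) :
  (forall i j, P (fun z => M z i j)) -> P (fun z => \det (M z)).
Proof.
move=> PM; rewrite /determinant.
apply: (@family_sum _ _
  (fun (s : {perm 'I_n}) z => (-1) ^+ s * \prod_i M z i (s i))) => s.
apply: familyM (family_cst _) _.
exact: (@family_prod _ _ (fun i z => M z i (s i))).
Qed.

Lemma family_cofactor (n : nat) (M : Z -> 'M[S]_n) i j :
  (forall i j, P (fun z => M z i j)) -> P (fun z => cofactor (M z) i j).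
Proof.
move=> PM; apply: familyM (family_cst _) _; apply: family_det => i' j'.
by under eq_fun do rewrite !mxE.
Qed.

Lemma family_mulmx (p q r : nat) (M : Z -> 'M[S]_(p, q)) (N : Z -> 'M[S]_(q, r)) :
    (forall i j, P (fun z => M z i j)) -> (forall i j, P (fun z => N z i j)) ->
  forall i j, P (fun z => (M z *m N z) i j).
Proof.
move=> PM PN i j; under eq_fun do rewrite mxE.
apply: (@family_sum _ _ (fun k z => M z i k * N z k j)) => k.
exact: familyM.
Qed.

End ClosedFamily.

(** * Polynomial functions and fractions of them *)

Section PolynomialFunctions.
Variables (R : realType) (N : nat).
Implicit Types f g : 'rV[R]_N -> R.

Definition poly_fun f :=
  exists p : mpoly N R, forall z, f z = meval (fun i => z ord0 i) p.

Lemma poly_fun_subring : subring_family poly_fun.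
Proof.
split=> [c|f g [p fp] [q gq]|f g [p fp] [q gq]].
- by exists (mpolyC N c) => z; rewrite mevalC.
- by exists (p + q) => z; rewrite mevalD fp gq.
- by exists (p * q) => z; rewrite mevalM fp gq.
Qed.

Lemma poly_fun_coord i : poly_fun (fun z => z ord0 i).
Proof. by exists (mpolyX R (mnm1 i)) => z; rewrite mevalXU. Qed.

Definition coef_poly_fun (f : 'rV[R]_N -> {poly R}) :=
  forall i, poly_fun (fun z => (f z)`_i).

Lemma coef_poly_fun_subring : subring_family coef_poly_fun.
Proof.
split=> [c i|f g Pf Pg i|f g Pf Pg i].
- exact: family_cst poly_fun_subring _.
- under eq_fun do rewrite coefD.
  exact: familyD poly_fun_subring _ _ (Pf i) (Pg i).
- under eq_fun do rewrite coefM.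
  apply: (@family_sum _ _ _ poly_fun_subring _ _
    (fun (j : 'I_i.+1) z => (f z)`_j * (g z)`_(i - j))) => j.
  exact: familyM poly_fun_subring _ _ (Pf j) (Pg (i - j)%N).
Qed.

Lemma coef_poly_funC f : poly_fun f -> coef_poly_fun (fun z => (f z)%:P).
Proof.
move=> Pf i; under eq_fun do rewrite coefC.
by case: eqP => // _; exact: family_cst poly_fun_subring _.
Qed.

(* Rational functions with a power of D as denominator. *)
Definition fraction_fun (D : 'rV[R]_N -> R) f :=
  exists k g, poly_fun g /\ forall z, D z != 0 -> D z ^+ k * f z = g z.

Section Fractions.
Variable D : 'rV[R]_N -> R.
Hypothesis polyD : poly_fun D.

Let polyXn k : poly_fun (fun z => D z ^+ k).
Proof.
elim: k => [|k IH]; first exact: family_cst poly_fun_subring _.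
under eq_fun do rewrite exprS.
exact: familyM poly_fun_subring _ _ polyD IH.
Qed.

Lemma fraction_fun_poly f : poly_fun f -> fraction_fun D f.
Proof. by exists 0, f; split => // z _; rewrite mul1r. Qed.

Lemma fraction_fun_subring : subring_family (fraction_fun D).
Proof.
split=> [c|f g [j [p [pp fp]]] [k [q [pq gq]]]|f g [j [p [pp fp]]] [k [q [pq gq]]]].
- exact/fraction_fun_poly/(family_cst poly_fun_subring).
- exists (j + k)%N, (fun z => D z ^+ k * p z + D z ^+ j * q z); split.
    by apply: (familyD poly_fun_subring); apply: (familyM poly_fun_subring).
  by move=> z Dz; rewrite -fp// -gq// exprD; ring.
- exists (j + k)%N, (fun z => p z * q z); split.
    exact: familyM poly_fun_subring _ _ pp pq.
  by move=> z Dz; rewrite -fp// -gq// exprD; ring.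
Qed.

Lemma fraction_fun_inv : fraction_fun D (fun z => (D z)^-1).
Proof.
exists 1, (fun=> 1); split; first exact: family_cst poly_fun_subring _.
by move=> z Dz; rewrite expr1 divff.
Qed.

Lemma eq_fraction_fun f g : (forall z, D z != 0 -> f z = g z) ->
  fraction_fun D g -> fraction_fun D f.
Proof.
move=> fg [k [p [pp gp]]]; exists k, p; split => // z Dz.
by rewrite fg// gp.
Qed.

End Fractions.

(** Cramer's rule. Where the determinant is 0, [invmx] returns the matrix itself, but [fraction_fun]
    claims nothing there. *)
Lemma fraction_fun_invmx (n : nat) (M : 'rV[R]_N -> 'M[R]_n) :
    (forall i j, poly_fun (fun z => M z i j)) ->
  forall i j, fraction_fun (fun z => \det (M z)) (fun z => invmx (M z) i j).
Proof.
move=> PM i j; have PD := family_det poly_fun_subring PM.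
apply: (eq_fraction_fun (g := fun z => (\det (M z))^-1 * cofactor (M z) j i)).
  by move=> z Dz; rewrite /invmx unitmxE unitfE Dz !mxE.
apply: (familyM (fraction_fun_subring PD)); first exact: fraction_fun_inv.
exact/fraction_fun_poly/(family_cofactor poly_fun_subring).
Qed.

Lemma poly_fun_line f (z0 d : 'rV[R]_N) : poly_fun f ->
  exists p : {poly R}, forall t, f (z0 + t *: d) = p.[t].
Proof.
case=> p fp.
exists (\sum_(mon <- msupp p) mcoeff mon p *:
  \prod_i ((z0 ord0 i)%:P + (d ord0 i)%:P * 'X) ^+ mon i) => t.
rewrite fp mevalE horner_sum; apply: eq_bigr => mon _.
rewrite hornerZ horner_prod; congr (_ * _); apply: eq_bigr => i _.
by rewrite horner_exp !hornerE !mxE [t * _]mulrC.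
Qed.

Lemma poly_nonroot (p : {poly R}) : p != 0 -> exists t, p.[t] != 0.
Proof.
move=> p0; apply: contrapT => np.
(* Otherwise the [size p] distinct numbers 0, 1, ... would all be roots, more than the degree
   allows. *)
have allr : all (root p) [seq i%:R | i <- iota 0 (size p)].
  by apply/allP => t _; apply: contrapT => /negP rt; apply: np; exists t.
have uniqr : uniq [seq i%:R : R | i <- iota 0 (size p)].
  by rewrite map_inj_uniq ?iota_uniq// => i j /eqP; rewrite eqr_nat => /eqP.
by have := max_poly_roots p0 allr uniqr; rewrite size_map size_iota ltnn.
Qed.

(** On the line through [z0] and [z1] both functions are nonzero univariate polynomials, and so is
    their product. *)
Lemma poly_fun_common_nonzero f g (z0 z1 : 'rV[R]_N) :
    poly_fun f -> poly_fun g -> f z0 != 0 -> g z1 != 0 ->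
  exists z, f z != 0 /\ g z != 0.
Proof.
move=> Pf Pg fz0 gz1.
have [p fp] := poly_fun_line z0 (z1 - z0) Pf.
have [q gq] := poly_fun_line z0 (z1 - z0) Pg.
have p0 : p != 0.
  apply: contraNneq fz0 => p0.
  by rewrite -[z0]addr0 -(scale0r (z1 - z0)) fp p0 horner0.
have q0 : q != 0.
  apply: contraNneq gz1 => q0.
  by rewrite -(subrK z0 z1) addrC -[z1 - z0]scale1r gq q0 horner0.
have [|t] := poly_nonroot (p := p * q); first by rewrite mulf_neq0.
rewrite hornerM mulf_eq0 negb_or => /andP[pt qt].
by exists (z0 + t *: (z1 - z0)); rewrite fp gq.
Qed.

End PolynomialFunctions.

(** * Genericity from polynomials that do not vanish identically *)

Section Genericity.
Variables (R : realType) (l n m : nat).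
Local Notation N := (l * n + l * n + l * m)%N.
Implicit Types z : 'rV[R]_N.

Definition E_of z : 'M[R]_(l, n) := vec_mx (lsubmx (lsubmx z)).
Definition A_of z : 'M[R]_(l, n) := vec_mx (rsubmx (lsubmx z)).
Definition B_of z : 'M[R]_(l, m) := vec_mx (rsubmx z).

Lemma Sigma_vecK z : Sigma_vec (E_of z, A_of z, B_of z) = z.
Proof. by rewrite /Sigma_vec !vec_mxK !hsubmxK. Qed.

Lemma E_of_vec (E A : 'M[R]_(l, n)) (B : 'M[R]_(l, m)) :
  E_of (Sigma_vec (E, A, B)) = E.
Proof. by rewrite /E_of !row_mxKl mxvecK. Qed.

Lemma A_of_vec (E A : 'M[R]_(l, n)) (B : 'M[R]_(l, m)) :
  A_of (Sigma_vec (E, A, B)) = A.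
Proof. by rewrite /A_of row_mxKl row_mxKr mxvecK. Qed.

Lemma B_of_vec (E A : 'M[R]_(l, n)) (B : 'M[R]_(l, m)) :
  B_of (Sigma_vec (E, A, B)) = B.
Proof. by rewrite /B_of row_mxKr mxvecK. Qed.

Lemma poly_fun_E i j : poly_fun (fun z => E_of z i j).
Proof. by under eq_fun do rewrite !mxE; exact: poly_fun_coord. Qed.

Lemma poly_fun_A i j : poly_fun (fun z => A_of z i j).
Proof. by under eq_fun do rewrite !mxE; exact: poly_fun_coord. Qed.

Lemma poly_fun_B i j : poly_fun (fun z => B_of z i j).
Proof. by under eq_fun do rewrite !mxE; exact: poly_fun_coord. Qed.

(** The hypersurface f = 0 contains the complement and is proper because [f] is nonzero
    somewhere. *)
Lemma generic_poly_fun (P : set (Sigma R l n m)) (f : 'rV[R]_N -> R) :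
    poly_fun f -> (exists z, f z != 0) ->
    (forall z, f z != 0 -> P (E_of z, A_of z, B_of z)) ->
  generic (@Sigma_vec R l n m @` P).
Proof.
move=> [p fp] [z0 fz0] fP; exists [set z | f z = 0]; split.
- exists [:: p]; apply/seteqP; split => z /= fz.
    by move=> q; rewrite inE => /eqP ->; rewrite -fp.
  by rewrite fp; apply: fz; rewrite inE.
- by move=> V; have : setT z0 by []; rewrite -V => /= /eqP; exact/negP.
move=> z /= nP; apply: contrapT => /eqP fz; apply: nP.
by exists (E_of z, A_of z, B_of z); [exact: fP|exact: Sigma_vecK].
Qed.

Lemma underdetermined_generic (n_gt0 : (0 < n)%N) : (l < n + m)%N ->
  generic (@Sigma_vec R l n m @` [set s | controllable s]).
Proof.
move=> l_lt.
apply: (generic_poly_fun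
  (f := fun z => \det (jet_mx n_gt0 (E_of z) (A_of z) (B_of z)))).
- apply: (family_det (poly_fun_subring _ _)) => j k; under eq_fun do rewrite mxE.
  pose subC := coef_poly_fun_subring R N.
  (* The entries of the jet matrix are coefficients of cofactors, so all coefficients are treated
     together. *)
  suff : coef_poly_fun
      (fun z => pencil_kernel n_gt0 (E_of z) (A_of z) (B_of z) (lshift m j)).
    by move=> /(_ k).
  apply: (family_cofactor subC) => i i'; under eq_fun do rewrite mxE.
  case: (nat_of_ord i == 0); first exact: (family_cst subC).
  case: (insub _) => [r|]; last exact: (family_cst subC).
  rewrite /pencil_entry; case: (fintype.split i') => k'.
    apply: (familyD subC).
      apply: (familyM subC); last exact: (family_cst subC).
      exact/coef_poly_funC/poly_fun_E.
    exact/(familyN subC)/coef_poly_funC/poly_fun_A.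
  exact/(familyN subC)/coef_poly_funC/poly_fun_B.
- exists (Sigma_vec (chain_E R l n, chain_A R l n, chain_B R l n m)).
  rewrite E_of_vec A_of_vec B_of_vec -unitfE.
  by have := chain_jet_unit R l m n_gt0; rewrite unitmxE.
by move=> z; rewrite -unitfE -unitmxE; exact: (jet_controllable l_lt).
Qed.

Lemma poly_fun_leading (tau : 'I_(n + m) -> 'I_l) i j :
  poly_fun (fun z => leading_mx (E_of z) (B_of z) tau i j).
Proof.
under eq_fun do rewrite mxE; case: (fintype.split j) => k /=.
  by under eq_fun do rewrite mxE; exact: poly_fun_E.
under eq_fun do rewrite 2!mxE.
exact/(familyN (poly_fun_subring _ _))/poly_fun_B.
Qed.

(** With [identity_B], makes the first n + m rows of [E, -B] the identity matrix and any further
    rows zero. *)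
Definition identity_E : 'M[R]_(l, n) := \matrix_(r, j) (r == j :> nat)%:R.
Definition identity_B : 'M[R]_(l, m) := \matrix_(r, j) - (r == n + j :> nat)%:R.

Lemma leading_identity (tau : 'I_(n + m) -> 'I_l) : (forall i, tau i = i :> nat) ->
  leading_mx identity_E identity_B tau = 1%:M.
Proof.
move=> tauE; apply/matrixP => i j; rewrite mxE [RHS]mxE -val_eqE/=.
by case: splitP => k ->; rewrite !mxE tauE ?opprK.
Qed.

(** The only division is in the inverse of [leading_mx]; everything else is built by ring
    operations. *)
Lemma observability_fraction (tau : 'I_(n + m) -> 'I_l) r0 :
  fraction_fun (fun z => \det (leading_mx (E_of z) (B_of z) tau))
    (fun z => \det (observability_mx (E_of z) (A_of z) (B_of z) tau r0)).
Proof.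
set D := fun z => _.
have PD : poly_fun D.
  by apply: (family_det (poly_fun_subring _ _)); exact: poly_fun_leading.
have subF := fraction_fun_subring PD.
pose G z := reduced_mx (E_of z) (A_of z) (B_of z) tau.
have PG i j : fraction_fun D (fun z => G z i j).
  apply: (family_mulmx subF) => {}i {}j.
    by apply: fraction_fun_invmx; exact: poly_fun_leading.
  by under eq_fun do rewrite mxE; exact/fraction_fun_poly/poly_fun_A.
have PGu i j : fraction_fun D (fun z => usubmx (G z) i j).
  by under eq_fun do rewrite mxE.
have PGd i j : fraction_fun D (fun z => dsubmx (G z) i j).
  by under eq_fun do rewrite mxE.
apply: (family_det subF) => k j; under eq_fun do rewrite mxE.
have sub_mxE (X Y : 'rV[R]_n) i i' : (X - Y) i i' = X i i' - Y i i'.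
  by rewrite !mxE.
elim: (k : nat) j => [|k' IH] j /=.
  under eq_fun do rewrite /output_row !sub_mxE.
  apply: (familyD subF); first apply: (familyD subF).
  - apply: (family_mulmx subF) => // i i'.
    by under eq_fun do rewrite mxE; exact/fraction_fun_poly/poly_fun_E.
  - apply: (familyN subF); under eq_fun do rewrite mxE.
    exact/fraction_fun_poly/poly_fun_A.
  - apply: (familyN subF); apply: (family_mulmx subF) => // i i'.
    by under eq_fun do rewrite mxE; exact/fraction_fun_poly/poly_fun_B.
by apply: (family_mulmx subF) => // i j'; rewrite ord1; exact: IH.
Qed.

(* The chain x_k' = x_(k+1), u = 0, together with the constraint x_1 = 0. *)
Definition observed_chain_A : 'M[R]_(l, n) :=
  \matrix_(r, j)
    ((j == r.+1 :> nat)%:R - ((r == n + m :> nat) && (j == 0 :> nat))%:R).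

(** Here the state matrix is the shift and the output row is the first unit vector, so c F^k runs
    through the unit vectors. *)
Lemma observability_chain (tau : 'I_(n + m) -> 'I_l) (r0 : 'I_l) :
    (0 < m)%N -> (forall i, tau i = i :> nat) -> r0 = (n + m)%N :> nat ->
  observability_mx identity_E observed_chain_A identity_B tau r0 = 1%:M.
Proof.
move=> m_gt0 tauE r0E.
set G := reduced_mx identity_E observed_chain_A identity_B tau.
have GE : G = rowsub tau observed_chain_A.
  by rewrite /G /reduced_mx leading_identity// invmx1 mul1mx.
have FE i j : usubmx G i j = (j == i.+1 :> nat)%:R.
  rewrite GE !mxE tauE/= (ltn_eqF (_ : i < n + m)%N) ?subr0//.
  by rewrite (leq_trans (ltn_ord i)) ?leq_addr.
have cE j : output_row identity_E observed_chain_A identity_B tau r0 ord0 j =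
    (j == 0 :> nat)%:R.
  rewrite /output_row.
  have -> : row r0 identity_E = 0.
    apply/rowP => k; rewrite !mxE r0E gtn_eqF//.
    by rewrite (leq_trans (ltn_ord k)) ?leq_addr.
  have -> : row r0 identity_B = 0.
    by apply/rowP => k; rewrite !mxE r0E eqn_add2l gtn_eqF ?oppr0.
  rewrite !mul0mx sub0r subr0 !mxE r0E eqxx ltn_eqF; last first.
    by rewrite (leq_trans (ltn_ord j))// -addnS leq_addr.
  by rewrite sub0r opprK.
apply/matrixP => k j; rewrite mxE [RHS]mxE -val_eqE/=.
case: k => k /=; elim: k j => [|k IH] j kn /=; first by rewrite cE eq_sym.
rewrite mxE -/G (bigD1 (Ordinal (ltnW kn)))//= IH; last exact: ltnW.
rewrite FE eqxx mul1r.
rewrite big1 ?addr0; first by rewrite eq_sym.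
move=> i; rewrite -val_eqE/= eq_sym => /negPf ik.
by rewrite IH ?ik ?mul0r// ltnW.
Qed.

Lemma overdetermined_generic : (0 < m)%N -> (n + m < l)%N ->
  generic (@Sigma_vec R l n m @` [set s | controllable s]).
Proof.
move=> m_gt0 l_gt.
pose tau : 'I_(n + m) -> 'I_l := widen_ord (ltnW l_gt).
pose r0 : 'I_l := Ordinal l_gt.
pose D z := \det (leading_mx (E_of z) (B_of z) tau).
have PD : poly_fun D.
  by apply: (family_det (poly_fun_subring _ _)); exact: poly_fun_leading.
have [k [g [Pg gE]]] : fraction_fun D _ := observability_fraction tau r0.
(* Where [D] is nonzero, [g] is a power of [D] times the observability determinant; so this product
   is nonzero only if both matrices are invertible. *)
apply: (generic_poly_fun (f := fun z => D z * g z)).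
- exact: (familyM (poly_fun_subring _ _)).
- exists (Sigma_vec (identity_E, observed_chain_A, identity_B)).
  have D1 : D (Sigma_vec (identity_E, observed_chain_A, identity_B)) = 1.
    by rewrite /D E_of_vec B_of_vec leading_identity ?det1.
  rewrite -gE ?D1 ?oner_eq0// expr1n !mul1r.
  by rewrite E_of_vec A_of_vec B_of_vec observability_chain ?det1 ?oner_eq0.
move=> z; rewrite mulf_eq0 negb_or => /andP[Dz]; rewrite -gE// mulf_eq0 negb_or.
move=> /andP[_ Oz]; apply: (@observable_controllable _ _ _ _ _ _ _ tau r0).
  by rewrite unitmxE unitfE.
by rewrite unitmxE unitfE.
Qed.

End Genericity.

(** Genericity would give a polynomial [p], nonzero somewhere, that vanishes at all uncontrollable
    systems. At a common nonzero of [p] and [D] the system would be controllable although [E, -B] is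
    invertible. *)
Lemma square_not_generic (R : realType) (n m : nat) : (0 < n)%N ->
  ~ generic (@Sigma_vec R (n + m) n m @` [set s | controllable s]).
Proof.
move=> n_gt0 [V [[ps VE] VT SV]].
have [z0 nVz0] : exists z, ~ V z.
  by apply: contrapT => nV; apply: VT; apply/seteqP; split => // z _;
    apply: contrapT => nVz; apply: nV; exists z.
have [p pps pz0] : exists2 p, p \in ps & meval (fun i => z0 ord0 i) p != 0.
  apply: contrapT => np; apply: nVz0; rewrite VE => p pps.
  by apply: contrapT => /eqP pz0; apply: np; exists p.
pose D (z : 'rV[R]_((n + m) * n + (n + m) * n + (n + m) * m)) :=
  \det (leading_mx (E_of z) (B_of z) (@id 'I_(n + m))).
have PD : poly_fun D.
  by apply: (family_det (poly_fun_subring _ _)); exact: poly_fun_leading.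
pose z1 := Sigma_vec (identity_E R (n + m) n, 0, identity_B R (n + m) n m).
have Dz1 : D z1 != 0.
  by rewrite /D E_of_vec B_of_vec leading_identity ?det1 ?oner_eq0.
have Pp : poly_fun (fun z => meval (fun i => z ord0 i) p) by exists p.
have [z [pz Dz]] := poly_fun_common_nonzero Pp PD pz0 Dz1.
have [s /= ctr sz] : (@Sigma_vec R (n + m) n m @` [set s | controllable s]) z.
  apply: contrapT => /SV; rewrite VE => /(_ p pps) pz'.
  by rewrite pz' eqxx in pz.
case: s ctr sz => [[E A] B] ctr sz; apply: (autonomous_uncontrollable _ n_gt0 ctr).
by move: Dz; rewrite -sz /D E_of_vec B_of_vec unitmxE unitfE.
Qed.

Theorem proposition5p14 (R : realType) (l n m : nat)
    (hl : (0 < l)%N) (hn : (0 < n)%N) (hm : (0 < m)%N) :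
  generic (@Sigma_vec R l n m @` [set s : Sigma R l n m | controllable s])
  <-> l <> (n + m)%N.
Proof.
split; first by move=> gen lE; subst l; exact: square_not_generic gen.
move=> /eqP; rewrite neq_ltn => /orP[|]; first exact: underdetermined_generic.
exact: overdetermined_generic.
Qed.
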